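(* For each $\epsilon > 0$, there is an efficient construction of an infinite family of number fields $E$ of increasing degree $n = [E:\mathbb{Q}]$ such that $D_E^{1/n} = O(n^{\epsilon})$.
   Context: For a number field $E$, $D_E$ denotes the absolute value of the discriminant of $E$ over $\mathbb{Q}$, and $D_E^{1/[E:\mathbb{Q}]}$ is its root discriminant. A family of number fields can be efficiently constructed (has an efficient construction) if there is an algorithm and a polynomial $f(x)\in\mathbb{R}[x]$ such that for each field $F$ in the family, the algorithm requires time bounded by $f(\log[F:\mathbb{Q}])$ for producing a set of polynomials whose roots generate $F$ (over $\mathbb{Q}$). *)

(* Defs.v *)
From HB Require Import structures.
From mathcomp Require Import all_boot all_order all_algebra all_field.
From mathcomp Require Import all_classical all_reals all_analysis.

Set Implicit Arguments.
Unset Strict Implicit.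
Unset Printing Implicit Defensive.

Import Order.TTheory GRing.Theory Num.Theory.
Import numFieldNormedType.Exports.

Local Open Scope ring_scope.

(* Number fields are the types L : fieldExtType rat, of degree \dim {:L}. *)

Section NumberField.
Variable L : fieldExtType rat.

(* The trace of the Q-linear map y |-> x * y of L. *)
Definition field_trace (x : L) : rat :=
  \sum_(i < \dim {:L}) coord (vbasis {:L}) i (x * (vbasis {:L})`_i).

Definition algebraic_integer (x : L) : Prop :=
  integralOver (intr : int -> L) x.

Definition integral_basis (b : (\dim {:L}).-tuple L) : Prop :=
  basis_of {:L} b /\
  forall x : L, algebraic_integer x <->
    exists c : 'I_(\dim {:L}) -> int, x = \sum_(i < \dim {:L}) b`_i *~ c i.

Definition basis_disc (b : (\dim {:L}).-tuple L) : rat :=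
  \det (\matrix_(i < \dim {:L}, j < \dim {:L}) field_trace (b`_i * b`_j)).

(* All integral bases have the same discriminant, so at most one D satisfies
   this predicate. *)
Definition is_absdisc (D : rat) : Prop :=
  exists2 b : (\dim {:L}).-tuple L, integral_basis b & D = `|basis_disc b|.

(* L is generated over Q by all the complex roots of the polynomials in ps,
   i.e., L is the splitting field of their product. The product of a list
   containing 0 does not split in the sense of splittingFieldFor, hence all the
   polynomials are nonzero. *)
Definition generated_by_roots (ps : seq {poly rat}) : Prop :=
  splittingFieldFor 1 (map_poly (in_alg L) (\prod_(p <- ps) p)) {:L}.

End NumberField.

(* Deterministic multitape Turing machines over {0, 1, blank}, with two-way
   infinite tapes; tape 0 is the input tape, the last one the output tape. *)

Inductive move := MoveLeft | Stay | MoveRight.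

Record machine := Machine {
  extra_tapes : nat;
  state : finType;
  start : state;
  halting : pred state;
  delta : state -> {ffun 'I_extra_tapes.+1 -> option bool} ->
          state * {ffun 'I_extra_tapes.+1 -> option bool * move} }.

(* (l, r) is the bi-infinite tape ... l_1 l_0 r_0 r_1 ..., padded with blanks
   (None) on both sides, with the head on r_0. *)
Definition tape : Type := seq (option bool) * seq (option bool).

Definition tape_read (t : tape) : option bool := head None t.2.

Definition tape_act (t : tape) (a : option bool * move) : tape :=
  let l := t.1 in
  let r := a.1 :: behead t.2 in
  match a.2 with
  | MoveLeft => (behead l, head None l :: r)
  | Stay => (l, r)
  | MoveRight => (head None r :: l, behead r)
  end.

Definition input_tape (w : seq bool) : tape := ([::], map Some w).

(* The word that starts at the head and ends before the next blank. *)
Fixpoint word_of (s : seq (option bool)) : seq bool :=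
  if s is Some b :: s' then b :: word_of s' else [::].

Section Run.
Variable M : machine.

Definition config : Type :=
  state M * {ffun 'I_(extra_tapes M).+1 -> tape}.

Definition initial (w : seq bool) : config :=
  (start M, [ffun i => input_tape (if i == ord0 then w else [::])]).

Definition step (c : config) : config :=
  if halting c.1 then c else
  let qa := delta c.1 [ffun i => tape_read (c.2 i)] in
  (qa.1, [ffun i => tape_act (c.2 i) (qa.2 i)]).

(* On input w, M halts after at most t steps with output v. *)
Definition computes_within (t : nat) (w v : seq bool) : Prop :=
  let c := iter t step (initial w) in
  halting c.1 /\ word_of (c.2 ord_max).2 = v.

End Run.

(* Binary digits without leading zeros, least significant digit first. *)
Definition binary (n : nat) : seq bool :=
  mkseq (fun i => odd (n %/ 2 ^ i)) (up_log 2 n.+1).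

(* Self-delimiting binary encoding of finite lists of rational polynomials,
   given by the dense lists of their coefficients: every item of a list is
   preceded by the bit 1, and the list is terminated by the bit 0. *)

Definition encode_seq (T : Type) (enc : T -> seq bool) (s : seq T) : seq bool :=
  flatten [seq true :: enc x | x <- s] ++ [:: false].

Definition encode_nat (n : nat) : seq bool :=
  encode_seq (fun b : bool => [:: b]) (binary n).

Definition encode_rat (q : rat) : seq bool :=
  (numq q < 0) :: encode_nat `|numq q|%N ++ encode_nat `|denq q|%N.

Definition encode_polys (ps : seq {poly rat}) : seq bool :=
  encode_seq (fun p : {poly rat} => encode_seq encode_rat p) ps.

(* On input j in binary, a single algorithm outputs polynomials whose roots
   generate E j, in time bounded by a polynomial in log [E j : Q]. *)
Definition efficiently_constructible (R : realType)
    (E : nat -> fieldExtType rat) : Prop :=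
  exists (M : machine) (f : {poly R}), forall j : nat,
  exists (t : nat) (ps : seq {poly rat}),
    [/\ computes_within M t (binary j) (encode_polys ps),
        generated_by_roots (E j) ps
      & t%:R <= f.[ln (\dim {:E j})%:R]].

(* Main.v *)
Require Import Defs.
From HB Require Import structures.
From mathcomp Require Import all_boot all_order all_algebra all_field.
From mathcomp Require Import all_classical all_reals all_analysis.
From mathcomp Require Import perm cyclic zify ring.

Import Order.TTheory GRing.Theory Num.Theory.
Import numFieldNormedType.Exports.

Local Open Scope classical_set_scope.
Local Open Scope ring_scope.

Set Implicit Arguments.
Unset Strict Implicit.
Unset Printing Implicit Defensive.

(** Fix s with 2 / s <= eps. For a prime p let E be the field generated by the
    roots of the X^p - a with 1 <= a and a^s <= p, that is, by a primitive p-th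
    root of unity z and the p-th roots of the primes q <= N, where N is about
    p^(1/s). By Kummer theory n = [E : Q] is (p - 1) p^r, where r is the number
    of these primes.

    The point is that the ramification above p is paid for only once. The
    order Z[z, al] with al^p = q has a discriminant with a large power of p, but
    if q is congruent modulo p^2 to the p-th power of an algebraic integer c of
    the field K already constructed, then (al - c) / (z - 1) is again an
    algebraic integer (algint_unity_quotient), and its powers form a basis of
    K(al) over K whose relative discriminant involves q only (level_step).
    The residues modulo p^2 prime to p are p-th powers times powers of a single
    residue. Therefore, once a prime q0 that is not a p-th power modulo p^2 has
    been adjoined, at the price of a factor p in the root discriminant, each
    of the other primes becomes a p-th power modulo p^2 (pow_near_power).
    Together with Q(z) this gives (kummer_field_disc)

      D_E^(1/n) <= C := p^2 * (product of the primes q <= N),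

    where C^s <= p^(2 s) N^(r s) <= p^(2 s + r). For r >= 2 s this is at most
    (p^r)^2 <= n^2, hence D_E^(1/n) <= n^(2 / s) <= n^eps.

    Discriminants are computed from the embeddings into the algebraic numbers:
    that of a basis is the square of the determinant of its conjugates
    (disc_embeddings), and for a tower this determinant splits into
    Vandermonde blocks (ndet_relative). Any basis of algebraic integers bounds
    the discriminant of the field, because an integral basis is one that
    minimises it (absdisc_exists).

    As for the time, log n is at least r log 2, and by a weak form of
    Chebyshev's theorem (chebyshev_weak) r is at least a fixed power of p.
    So it is enough to write the polynomials down in time polynomial in p,
    and this leaves room for trial division on unary counters: the program
    is written in a small while language (exec), compiled to a Turing
    machine (machine_of_correct), and its running time is bounded by a
    polynomial in p (program_correct, time_poly_bounded). The j-th field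
    uses the j-th prime. *)

(** * Algebraic integers and integral bases *)

Section AlgebraicIntegers.
Variable L : fieldExtType rat.
Local Notation intL := (intr : {rmorphism int -> L}).

Lemma algint_int (m : int) : algebraic_integer (m%:~R : L).
Proof. exact: (integral_id intL). Qed.

Lemma algint_add (x y : L) :
  algebraic_integer x -> algebraic_integer y -> algebraic_integer (x + y).
Proof. exact: (@integral_add _ _ intL). Qed.

Lemma algint_sub (x y : L) :
  algebraic_integer x -> algebraic_integer y -> algebraic_integer (x - y).
Proof. exact: (@integral_sub _ _ intL). Qed.

Lemma algint_mul (x y : L) :
  algebraic_integer x -> algebraic_integer y -> algebraic_integer (x * y).
Proof. exact: (@integral_mul _ _ intL). Qed.

Lemma algint_exp (x : L) k : algebraic_integer x -> algebraic_integer (x ^+ k).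
Proof.
by move=> xi; elim: k => [|k IH]; [exact: (algint_int 1) | rewrite exprS; exact: algint_mul].
Qed.

Lemma algint_sum I (r : seq I) (P : pred I) (F : I -> L) :
  (forall i, P i -> algebraic_integer (F i)) ->
  algebraic_integer (\sum_(i <- r | P i) F i).
Proof. by apply: big_ind; [exact: (algint_int 0) | exact: algint_add]. Qed.

Lemma algint_prod I (r : seq I) (P : pred I) (F : I -> L) :
  (forall i, P i -> algebraic_integer (F i)) ->
  algebraic_integer (\prod_(i <- r | P i) F i).
Proof. by apply: big_ind; [exact: (algint_int 1) | exact: algint_mul]. Qed.

Lemma algint_root_monic (q : {poly L}) x : q \is monic -> root q x ->
  (forall i, algebraic_integer q`_i) -> algebraic_integer x.
Proof.
move=> qm qx qi; apply: (integral_root_monic qm qx) => y.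
by move/(integral_poly intL): qi; apply.
Qed.
End AlgebraicIntegers.

Section Discriminant.
Variable L : fieldExtType rat.
Local Notation n := (\dim {:L}).

Definition embedding_mx m (s : 'I_m -> {rmorphism L -> algC}) (b : 'I_m -> L) :
  'M[algC]_m := \matrix_(i, j) s i (b j).

(** The embeddings are linear over Q, so the coefficients of a linear relation
    between the b_j form a vector that this matrix kills. *)
Lemma embedding_mx_free m (s : 'I_m -> {rmorphism L -> algC}) (b : m.-tuple L) :
  \det (embedding_mx s (fun j => b`_j)) != 0 -> free b.
Proof.
move=> nz; apply/freeP => k k0 i.
pose c : 'cV[algC]_m := \col_j ratr (k j).
suff: c = 0 by move/matrixP/(_ i 0); rewrite !mxE => /eqP; rewrite fmorph_eq0 => /eqP.
have Mu : embedding_mx s (fun j => b`_j) \in unitmx by rewrite unitmxE unitfE.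
suff Mc : embedding_mx s (fun j => b`_j) *m c = 0.
  by rewrite -[c](mulKmx Mu) Mc mulmx0.
apply/matrixP => a o; rewrite !mxE.
transitivity (s a (\sum_(j < m) k j *: b`_j)); last by rewrite k0 rmorph0.
by rewrite rmorph_sum; apply: eq_bigr => j _; rewrite !mxE rmorphZ_num mulrC.
Qed.

Lemma Aint_embedding (f : {rmorphism L -> algC}) x :
  algebraic_integer x -> f x \in Aint.
Proof.
case=> p pm px; apply: (@root_monic_Aint (map_poly f (map_poly intr p))).
- by rewrite fmorph_root.
- by rewrite !monic_map.
by apply/polyOverP => i; rewrite !coef_map /= rmorph_int; exact: intr_int.
Qed.

Variable s : 'I_n -> {rmorphism L -> algC}.
Local Notation S b := (embedding_mx s (fun j => b`_j)).

Lemma embedding_mx_change (b b' : n.-tuple L) : basis_of {:L} b ->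
  S b' = S b *m \matrix_(k, j) ratr (coord b k b'`_j).
Proof.
move=> bb; apply/matrixP => i j; rewrite !mxE.
rewrite [X in s i X](coord_basis bb (memvf _)) rmorph_sum.
by apply: eq_bigr => k _; rewrite !mxE rmorphZ_num mulrC.
Qed.

Variable b0 : n.-tuple L.
Hypothesis b0_det : \det (S b0) != 0.

Lemma basis_b0 : basis_of {:L} b0.
Proof. by rewrite basisEfree (embedding_mx_free b0_det) subvf size_tuple /=. Qed.

Lemma embedding_mx_unit (b : n.-tuple L) : basis_of {:L} b -> \det (S b) != 0.
Proof.
move=> bb; have := b0_det; rewrite (embedding_mx_change b0 bb) det_mulmx.
by rewrite mulf_eq0 negb_or => /andP[].
Qed.

(** If S is the matrix of conjugates of a basis and M is the matrix of the
    multiplication by x, then S M = diag (s_i x) S: M is diagonalised by S. *)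
Lemma trace_embeddings x : ratr (field_trace x) = \sum_i s i x.
Proof.
have vb := vbasisP {:L}; set v := vbasis {:L} in vb.
have Mu : S v \in unitmx by rewrite unitmxE unitfE (embedding_mx_unit vb).
pose M := \matrix_(k < n, j < n) (ratr (coord v k (x * v`_j)) : algC).
have SM : diag_mx (\row_i s i x) *m S v = S v *m M.
  rewrite mul_diag_mx; apply/matrixP => i j; rewrite !mxE.
  rewrite -rmorphM [X in s i X](coord_basis vb (memvf _)) rmorph_sum.
  by apply: eq_bigr => k _; rewrite !mxE rmorphZ_num mulrC.
have -> : ratr (field_trace x) = \tr M.
  by rewrite rmorph_sum; apply: eq_bigr => i _; rewrite mxE.
rewrite -[M](mulKmx Mu) -SM mxtrace_mulC mulmxK // mxtrace_diag.
by apply: eq_bigr => i _; rewrite mxE.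
Qed.

(** By [trace_embeddings] the Gram matrix of the trace form is S^T S. *)
Lemma disc_embeddings (b : n.-tuple L) : ratr (basis_disc b) = \det (S b) ^+ 2.
Proof.
rewrite -det_map_mx expr2 -[X in X * _]det_tr -det_mulmx; congr (\det _).
apply/matrixP => i j; rewrite !mxE /= trace_embeddings.
by apply: eq_bigr => k _; rewrite !mxE rmorphM.
Qed.

Lemma trace_int (x : L) : algebraic_integer x -> field_trace x \is a Num.int.
Proof.
move=> xi; have : (ratr (field_trace x) : algC) \in Num.int.
  apply: Cint_rat_Aint; first exact: Crat_rat.
  by rewrite trace_embeddings rpred_sum // => i _; apply: Aint_embedding.
by case/intrP => m; rewrite -(ratr_int algC) => /fmorph_inj ->; exact: intr_int.
Qed.

Lemma disc_int (b : n.-tuple L) : (forall i : 'I_n, algebraic_integer b`_i) ->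
  basis_disc b \is a Num.int.
Proof.
move=> bi; rewrite /basis_disc rpred_sum // => p _; rewrite rpredMsign rpred_prod // => i _.
by rewrite mxE; apply: trace_int; apply: algint_mul; apply: bi.
Qed.

(** This is the determinant of the change of basis that replaces the k-th
    vector of a basis by the vector with coordinates c. *)
Lemma det_row_replaced (R : comPzRingType) m (k : 'I_m) (c : 'I_m -> R) :
  \det (\matrix_(i, j) (if i == k then c j else (i == j)%:R)) = c k.
Proof.
set M := (\matrix_(i, j) _).
rewrite (expand_det_row _ k).
have cof j : cofactor M k j = (k == j)%:R.
  have <- : cofactor 1%:M k j = (k == j)%:R :> R.
    have /matrixP/(_ j k) : \adj (1%:M : 'M[R]_m) = 1%:M.
      by have := mul_mx_adj (1%:M : 'M[R]_m); rewrite mul1mx det1.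
    by rewrite !mxE eq_sym.
  rewrite /cofactor; congr (_ * \det _).
  by apply/matrixP => i l; rewrite !mxE eq_sym (negbTE (neq_lift _ _)).
rewrite (bigD1 k) //= big1 => [|j jk]; rewrite cof mxE eqxx.
  by rewrite mulr1 addr0.
by rewrite eq_sym (negbTE jk) mulr0.
Qed.

(** Among the bases that consist of algebraic integers, choose one whose
    discriminant is minimal in absolute value. Were the k-th coordinate of an
    algebraic integer x not an integer, subtracting from x a multiple of the
    k-th basis vector would leave a coordinate f with 0 < f < 1, and
    exchanging this difference for the k-th vector would multiply the
    discriminant by f^2. So the chosen basis is integral, and by its choice
    its discriminant is bounded by that of [b0]. *)
Theorem absdisc_exists : (forall i : 'I_n, algebraic_integer b0`_i) ->
  exists2 D, is_absdisc L D & ratr D <= `|\det (S b0)| ^+ 2.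
Proof.
move=> b0i.
pose P d := `[< exists b : n.-tuple L, [/\ basis_of {:L} b,
   forall i : 'I_n, algebraic_integer b`_i & `|basis_disc b| = d%:R ] >].
have natdisc (b : n.-tuple L) : (forall i : 'I_n, algebraic_integer b`_i) ->
    exists d : nat, `|basis_disc b| = d%:R.
  move=> bi; case/intrP: (disc_int bi) => z ->; exists `|z|%N.
  by rewrite -intr_norm -abszE.
have exP : exists d, P d.
  have [d0 Ed0] := natdisc _ b0i.
  by exists d0; apply/asboolP; exists b0; split => //; exact: basis_b0.
case: (ex_minnP exP) => d /asboolP[b [bb bi bd]] dmin.
have d_le (b' : n.-tuple L) : basis_of {:L} b' -> (forall i : 'I_n, algebraic_integer b'`_i) ->
    `|basis_disc b| <= `|basis_disc b'|.
  move=> bb' bi'; have [d' Ed'] := natdisc _ bi'.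
  by rewrite bd Ed' ler_nat dmin //; apply/asboolP; exists b'.
exists `|basis_disc b|; last first.
  apply: (@le_trans _ _ (ratr `|basis_disc b0|)).
    by rewrite ler_rat; apply: d_le => //; exact: basis_b0.
  by rewrite ratr_norm disc_embeddings normrX.
exists b => //; split=> // x; split; last first.
  move=> [c ->]; apply: algint_sum => i _.
  by rewrite -mulrzr; apply: algint_mul (bi i) (algint_int _ _).
move=> xi.
have xE := coord_basis bb (memvf x).
suff cz k : coord b k x \is a Num.int.
  have /all_sig[c cE] k : {m | coord b k x = m%:~R}.
    by exists (Num.floor (coord b k x)); rewrite floorK.
  by exists c; rewrite {1}xE; apply: eq_bigr => i _; rewrite cE scaler_int.
(* the fractional part of the k-th coordinate *)
pose f := coord b k x - (Num.floor (coord b k x))%:~R.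
apply: contraT => nint.
have f_gt0 : 0 < f.
  rewrite lt0r subr_eq0 subr_ge0 floor_le andbT.
  by apply: contra nint => /eqP ->; exact: intr_int.
have f_lt1 : f < 1 by rewrite ltrBlDl -[1]/(1%:~R) -intrD floorD1_gt.
pose y := x - b`_k *~ Num.floor (coord b k x).
pose b' := [tuple (if i == k then y else b`_i) | i < n].
have b'E (i : 'I_n) : b'`_i = if i == k then y else b`_i.
  by rewrite -tnth_nth tnth_mktuple.
have Sb' : S b' = S b *m (\matrix_(i, j) (if i == k then
   (ratr (coord b j x) - (j == k)%:R * ratr (Num.floor (coord b k x))%:~R) else (i == j)%:R))^T.
  apply/matrixP => i j; rewrite !mxE b'E; case: eqP => [->|jk].
    rewrite rmorphB rmorphMz {1}xE rmorph_sum.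
    under [in RHS]eq_bigr => l _ do rewrite !mxE eqxx mulrBr.
    rewrite sumrB; congr (_ - _).
      by apply: eq_bigr => l _; rewrite rmorphZ_num mulrC.
    rewrite (bigD1 k) //= big1 => [|l lk]; first by rewrite eqxx mul1r addr0 rmorph_int mulrzr.
    by rewrite (negbTE lk) mul0r mulr0.
  rewrite (bigD1 j) //= big1 => [|l lj]; first by rewrite !mxE (introF eqP jk) eqxx mulr1 addr0.
  by rewrite !mxE (introF eqP jk) eq_sym (negbTE lj) mulr0.
have dSb' : \det (S b') = ratr f * \det (S b).
  by rewrite Sb' det_mulmx det_tr (det_row_replaced _ (fun j => _)) eqxx mul1r -rmorphB mulrC.
have b'_det : \det (S b') != 0.
  by rewrite dSb' mulf_neq0 ?(embedding_mx_unit bb) // fmorph_eq0 gt_eqF.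
have bb' : basis_of {:L} b'.
  by rewrite basisEfree (embedding_mx_free b'_det) subvf size_tuple /=.
have b'i (i : 'I_n) : algebraic_integer b'`_i.
  rewrite b'E; case: eqP => _; last exact: bi.
  apply: algint_sub => //; rewrite -mulrzr.
  exact: algint_mul (bi k) (algint_int _ _).
have := d_le _ bb' b'i.
have discb' : basis_disc b' = f ^+ 2 * basis_disc b.
  apply: (fmorph_inj (ratr : {rmorphism rat -> algC})).
  by rewrite /= disc_embeddings dSb' rmorphM rmorphXn /= exprMn -disc_embeddings.
rewrite discb' normrM ler_pMl ?normr_gt0; last first.
  rewrite -(fmorph_eq0 (ratr : {rmorphism rat -> algC})) /= disc_embeddings expf_neq0 //.
  exact: embedding_mx_unit.
rewrite ger0_norm ?sqr_ge0 // => f2.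
by move: f2; rewrite leNgt exprn_ilt1 // ltW.
Qed.
End Discriminant.

(** * Determinants along a tower *)

Section BlockDeterminant.
Variable R : comPzRingType.
Implicit Types f A : nat -> nat -> R.

(** The entries are indexed by natural numbers, so that the determinants of
    sizes m * p and p * m, which occur when a tensor product is reordered, have
    entries of the same type and can be compared by rewriting. *)
Definition ndet n f : R := \det (\matrix_(i < n, j < n) f i j).

Lemma eq_ndet n f g : (forall i j, (i < n)%N -> (j < n)%N -> f i j = g i j) ->
  ndet n f = ndet n g.
Proof. by move=> fg; congr (\det _); apply/matrixP => i j; rewrite !mxE fg. Qed.

Lemma ndet_block_diag m p (B : nat -> nat -> nat -> R) : (0 < p)%N ->
  ndet (m * p) (fun k l => (k %/ p == l %/ p)%N%:R * B (k %/ p)%N (k %% p)%N (l %% p)%N)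
  = \prod_(x < m) ndet p (B x).
Proof.
move=> p0; elim: m B => [|m IH] B; first by rewrite big_ord0 /ndet det_mx00.
rewrite big_ord_recl -(IH (fun x => B x.+1)).
rewrite /ndet -(det_ublock _ 0); congr (\det _).
apply/matrixP => k l; rewrite -(@splitK p (m * p) k) -(@splitK p (m * p) l).
case: (fintype.split k) => k'; case: (fintype.split l) => l' /=;
  rewrite ?(block_mxEul, block_mxEur, block_mxEdl, block_mxEdr) !mxE /=.
- by rewrite !divn_small // !modn_small // mul1r.
- by rewrite divn_small // divnDl ?dvdnn // divnn p0 mul0r.
- by rewrite [in X in _ == X]divn_small // divnDl ?dvdnn // divnn p0 mul0r.
- by rewrite !divnDl ?dvdnn // !divnn p0 !modnDl.
Qed.

Lemma ndet_perm n (s : nat -> nat) f : (forall i, (i < n)%N -> (s i < n)%N) ->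
  {in gtn n &, injective s} -> ndet n (fun i j => f (s i) (s j)) = ndet n f.
Proof.
move=> sn s_inj; pose t (i : 'I_n) := Ordinal (sn _ (ltn_ord i)).
have t_inj : injective t by move=> i j [] /s_inj/val_inj; apply; rewrite inE.
pose M := \matrix_(i < n, j < n) f i j.
rewrite /ndet -/M.
have -> : \matrix_(i < n, j < n) f (s i) (s j) = row_perm (perm t_inj) (col_perm (perm t_inj) M).
  by apply/matrixP => i j; rewrite !mxE !permE.
by rewrite row_permE col_permE !det_mulmx !det_perm odd_permV mulrC -mulrA -expr2 sqrr_sign mulr1.
Qed.

(** This is det (A (x) 1) = (det A)^p: exchanging the two digits of the
    indices turns A (x) 1 into the block diagonal matrix 1 (x) A. *)
Lemma ndet_scalar_blocks m p A : (0 < p)%N ->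
  ndet (m * p) (fun k l => A (k %/ p)%N (l %/ p)%N * (k %% p == l %% p)%N%:R) = ndet m A ^+ p.
Proof.
move=> p0; have [->|m0] := posnP m; first by rewrite /ndet !det_mx00 expr1n.
pose s k := (k %% m * p + k %/ m)%N.
have dm i : (i < m * p)%N -> (i %/ m < p)%N by rewrite ltn_divLR // mulnC.
have sm i : (i < m * p)%N -> (s i %/ p = i %% m)%N.
  by move=> ip; rewrite /s divnMDl // divn_small ?addn0 // dm.
have sd i : (i < m * p)%N -> (s i %% p = i %/ m)%N.
  by move=> ip; rewrite /s modnMDl modn_small // dm.
rewrite -(@ndet_perm _ s) => [|i ip|i j].
- transitivity (ndet (p * m) (fun k l => (k %/ m == l %/ m)%N%:R * A (k %% m)%N (l %% m)%N)).
    by rewrite [in RHS]mulnC; apply: eq_ndet => i j ip jp; rewrite !sm ?sd // mulrC.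
  by rewrite (ndet_block_diag _ (fun _ => A)) // prodr_const card_ord.
- apply: (@leq_trans (i %% m * p + p)); first by rewrite ltn_add2l dm.
  by rewrite -mulSnr leq_mul2r ltn_pmod // orbT.
rewrite !inE => ip jp sE.
by rewrite (divn_eq i m) (divn_eq j m) -sm // -(sm j) // -(sd i) // -(sd j) // sE.
Qed.

(** The determinant behind the discriminant formula of a tower: k = x * p + y
    stands for the extension number y of the embedding number x, and l = i * p
    + j for the product of the i-th basis element of the base field with the
    j-th relative one. The matrix is the product of the block diagonal matrix
    with blocks B x and of A (x) 1. *)
Lemma ndet_relative m p A (B : nat -> nat -> nat -> R) : (0 < p)%N ->
  ndet (m * p) (fun k l => A (k %/ p)%N (l %/ p)%N * B (k %/ p)%N (k %% p)%N (l %% p)%N)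
  = ndet m A ^+ p * \prod_(x < m) ndet p (B x).
Proof.
move=> p0; rewrite -(ndet_scalar_blocks _ _ p0) -(ndet_block_diag _ _ p0) mulrC.
rewrite /ndet -det_mulmx; congr (\det _); apply/matrixP => k l; rewrite !mxE.
have mp : (k %/ p * p + l %% p < m * p)%N.
  have := ltn_ord k; have -> : (k < m * p)%N = (k %/ p < m)%N by rewrite ltn_divLR.
  move=> km; apply: (@leq_trans (k %/ p * p + p)); first by rewrite ltn_add2l ltn_pmod.
  by rewrite -mulSnr leq_mul2r km orbT.
rewrite (bigD1 (Ordinal mp)) //= big1 => [|i ine].
  rewrite !mxE /= divnMDl // [((l %% p) %/ p)%N]divn_small ?ltn_pmod // addn0.
  rewrite modnMDl modn_mod !eqxx.
  by rewrite mul1r mulr1 addr0 mulrC.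
rewrite !mxE; have [ki|] := eqVneq; last by rewrite !mul0r.
have [il|] := eqVneq (i %% p)%N; last by rewrite !mulr0.
by case/eqP: ine; apply/val_inj; rewrite /= ki -il -divn_eq.
Qed.

Lemma ndet_Vandermonde n (a : nat -> R) :
  ndet n (fun i j => a i ^+ j) = \prod_(i < n) \prod_(j < n | (i < j)%N) (a j - a i).
Proof.
rewrite /ndet -det_tr -[X in _ = X](_ : \det (Vandermonde n (\row_j a j)) = _).
  by congr (\det _); apply/matrixP => i j; rewrite !mxE.
by rewrite det_Vandermonde; apply: eq_bigr => i _; apply: eq_bigr => j _; rewrite !mxE.
Qed.
End BlockDeterminant.

(** * Roots of unity *)

(** Both sides are the value at w^i of the derivative of
    X^p - 1 = \prod_j (X - w^j). *)
Lemma prod_root_unity_diff (F : fieldType) p (w : F) i : p.-primitive_root w -> (i < p)%N ->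
  \prod_(j < p | j != i :> nat) (w ^+ i - w ^+ j) = p%:R * w ^+ (i * p.-1).
Proof.
move=> pw ip; have p0 := prim_order_gt0 pw.
have := congr1 (fun f => (deriv f).[w ^+ i]) (factor_Xn_sub_1 pw).
rewrite big_mkord (bigD1 (Ordinal ip)) //= derivM derivXsubC mul1r.
rewrite hornerD hornerM !hornerE subrr mul0r addr0 derivB derivXn -polyC1 derivC subr0.
rewrite hornerMn hornerXn horner_prod -exprM mulr_natl => <-.
by apply: eq_bigr => j _; rewrite hornerXsubC.
Qed.

Lemma prod_root_unity_sub1 (F : fieldType) p (w : F) : p.-primitive_root w ->
  \prod_(j < p.-1) (1 - w ^+ j.+1) = p%:R.
Proof.
move=> pw; have := prod_root_unity_diff pw (prim_order_gt0 pw).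
case: p pw => // p pw; rewrite mul0n expr0 mulr1 => <- /=.
rewrite [in RHS]big_mkcond big_ord_recl /= mul1r.
by apply: eq_bigr => j _; rewrite ?expr0 /bump.
Qed.

(** Passing to ordered pairs collects the factors with a fixed i, which for the
    powers of a root of unity is the product of [prod_root_unity_diff]. *)
Lemma norm_prod_offdiag (F : numFieldType) n (a : nat -> F) :
  `|\prod_(i < n) \prod_(j < n | (i < j)%N) (a j - a i)| ^+ 2 =
  \prod_(i < n) \prod_(j < n | j != i :> nat) `|a i - a j|.
Proof.
rewrite expr2 normr_prod.
under eq_bigr => i _ do rewrite normr_prod.
rewrite [X in X * _](exchange_big_dep xpredT) //= -big_split /=; apply: eq_bigr => i _.
rewrite [RHS](bigID (fun j : 'I_n => (j < i)%N)) /=; congr (_ * _).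
  by apply: eq_bigl => j; rewrite neq_ltn; case: ltngtP.
rewrite [RHS](eq_bigl (fun j : 'I_n => (i < j)%N)) => [|j].
  by apply: eq_bigr => j _; rewrite distrC.
by rewrite /= neq_ltn; case: ltngtP.
Qed.

Lemma norm_disc_unity p (w : algC) : p.-primitive_root w ->
  \prod_(i < p) \prod_(j < p | j != i :> nat) `|w ^+ i - w ^+ j| = (p ^ p)%:R.
Proof.
move=> pw; have p0 := prim_order_gt0 pw.
have nw : `|w| = 1.
  apply/eqP; rewrite -(pexpr_eq1 p0) // -normrX.
  by rewrite (prim_expr_order pw) normr1.
rewrite natrX -[X in _ ^+ X](card_ord p) -prodr_const; apply: eq_bigr => i _.
rewrite -normr_prod prod_root_unity_diff // normrM normrX nw expr1n mulr1.
by rewrite normr_nat.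
Qed.

Lemma algint_nat (L : fieldExtType rat) n : algebraic_integer (n%:R : L).
Proof. exact: (algint_int L (Posz n)). Qed.

Lemma algint_root_nat (L : fieldExtType rat) p (x : L) a : (0 < p)%N ->
  x ^+ p = a%:R -> algebraic_integer x.
Proof.
move=> p0 xp; apply: (@algint_root_monic _ ('X^p - a%:R%:P)) => [||i].
- exact: monicXnsubC.
- by rewrite /root !hornerE xp subrr.
rewrite coefB coefXn coefC; apply: algint_sub; first exact: algint_nat.
by case: eqP => _; [exact: algint_nat | exact: (algint_nat L 0)].
Qed.

(** The prime p is totally ramified in Q(z): up to sign the quotient u is the
    product of the cyclotomic units (1 - z^j) / (1 - z). *)
Lemma unity_sub1_dvd (L : fieldExtType rat) p (z : L) : p.-primitive_root z ->
  exists2 u : L, algebraic_integer u & p%:R = u * (z - 1) ^+ p.-1.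
Proof.
move=> pz; exists ((-1) ^+ p.-1 * \prod_(j < p.-1) \sum_(i < j.+1) z ^+ i).
  have zi := algint_root_nat (prim_order_gt0 pz) (prim_expr_order pz : _ = 1%:R).
  apply: algint_mul; first by apply: algint_exp; exact: (algint_int _ (-1)).
  by apply: algint_prod => j _; apply: algint_sum => i _; apply: algint_exp.
rewrite -(prod_root_unity_sub1 pz) mulrAC -exprMn mulN1r opprB.
rewrite -[X in _ ^+ X](card_ord p.-1) -prodr_const -big_split /=.
by apply: eq_bigr => j _; rewrite -[LHS]opprB subrX1 -mulNr opprB.
Qed.

(** With P = z - 1, the quotient is a root of P^-p ((P X + c)^p - a), which is
    monic. Its inner coefficients contain the factor 'C(p, i) P^i / P^p, which
    is integral because p is an integral multiple of P^(p-1); the constant one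
    is p^2 w / P^p, integral because p <= 2 (p - 1). *)
Lemma algint_unity_quotient (L : fieldExtType rat) p (z al c w : L) (a : nat) :
  prime p -> p.-primitive_root z -> al ^+ p = a%:R ->
  algebraic_integer c -> algebraic_integer w -> c ^+ p = a%:R + p%:R ^+ 2 * w ->
  algebraic_integer ((al - c) / (z - 1)).
Proof.
move=> pp pz ala ci wi cp.
have p0 := prime_gt0 pp; have p1 := prime_gt1 pp.
have z1 : z - 1 != 0.
  rewrite subr_eq0; apply: contraTneq pz => ->.
  by apply/negP => /prim_order_dvd/(_ 1%N); rewrite expr1 eqxx dvdn1 gtn_eqF.
have zi : algebraic_integer (z - 1).
  apply: algint_sub (algint_int _ 1).
  exact: (algint_root_nat p0 (prim_expr_order pz : _ = 1%:R)).
have [u ui uE] := unity_sub1_dvd pz.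
set P := z - 1 in z1 zi uE *.
pose f := \poly_(i < p.+1) ((c ^+ (p - i) * P ^+ i *+ 'C(p, i) - (i == 0)%N%:R * a%:R) / P ^+ p).
have fp : f`_p = 1.
  by rewrite coef_poly ltnSn subnn expr0 binn mul1r eqn0Ngt p0 mul0r subr0 divff // expf_neq0.
have sf : size f = p.+1.
  by apply/eqP; rewrite eqn_leq size_poly ltnNge; apply/negP => /leq_sizeP/(_ p (leqnn _))/eqP; rewrite fp oner_eq0.
apply: (@algint_root_monic _ f) => [||i].
- by apply/monicP; rewrite /lead_coef sf.
- rewrite /root horner_poly.
  under eq_bigr => i _ do rewrite mulrAC mulrBl.
  rewrite -mulr_suml sumrB.
  have -> : \sum_(i < p.+1) c ^+ (p - i) * P ^+ i *+ 'C(p, i) * ((al - c) / P) ^+ i = a%:R.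
    rewrite -ala -[in RHS](subrKC c al) exprDn; apply: eq_bigr => i _.
    by rewrite mulrnAl -mulrA -exprMn mulrCA mulfV // mulr1.
  rewrite big_ord_recl big1 => [|i _]; last by rewrite /= !mul0r.
  by rewrite eqxx expr0 mulr1 mul1r addr0 subrr mul0r.
rewrite coef_poly; case: ltnP => [|_]; last exact: (algint_int _ 0).
rewrite ltnS leq_eqVlt => /predU1P[->|ip].
  by rewrite subnn expr0 binn mul1r eqn0Ngt p0 mul0r subr0 divff ?expf_neq0 //; exact: (algint_int _ 1).
have PE : P ^+ p = P * P ^+ p.-1 by rewrite -exprS prednK.
have uP : p%:R / P ^+ p.-1 = u by rewrite uE mulfK // expf_neq0.
case: (posnP i) => [->|i0].
  rewrite subn0 expr0 mulr1 bin0 mul1r cp addrC addKr.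
  have -> : p%:R ^+ 2 * w / P ^+ p = u ^+ 2 * P ^+ p.-2 * w.
    have PE2 : P ^+ p.-1 = P * P ^+ p.-2 by rewrite -exprS prednK // -ltnS prednK.
    rewrite -uP PE PE2; move: (P ^+ p.-2) (expf_neq0 p.-2 z1) => Q Q0.
    by field; rewrite z1 Q0.
  by apply: algint_mul => //; apply: algint_mul; exact: algint_exp.
rewrite mul0r subr0.
have /dvdnP[m ->] : (p %| 'C(p, i))%N by rewrite prime_dvd_bin // i0.
have -> : c ^+ (p - i) * P ^+ i *+ (m * p) / P ^+ p = c ^+ (p - i) * u * P ^+ i.-1 * m%:R.
  have -> : P ^+ i = P * P ^+ i.-1 by rewrite -exprS prednK.
  rewrite -mulr_natr natrM -uP PE; move: (P ^+ p.-1) (expf_neq0 p.-1 z1) => Q Q0.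
  by field; rewrite z1 Q0.
apply: algint_mul (algint_int _ (Posz m)); apply: algint_mul (algint_exp _ zi).
by apply: algint_mul => //; apply: algint_exp.
Qed.

(** * Kummer theory *)

Lemma adjoin_degree_le (F : fieldType) (L : fieldExtType F) (K : {subfield L}) (x : L) (f : {poly L}) :
  f != 0 -> f \is a polyOver K -> root f x -> (adjoin_degree K x < size f)%N.
Proof.
by move=> f0 fK fx; rewrite -size_minPoly dvdp_leq // minPoly_dvdp.
Qed.

Lemma dim_Fadjoin_le (F : fieldType) (L : fieldExtType F) (K : {subfield L}) (x : L) p a :
  (0 < p)%N -> a \in K -> x ^+ p = a -> (\dim <<K; x>> <= \dim K * p)%N.
Proof.
move=> p0 aK xp; rewrite dim_Fadjoin mulnC leq_mul2l.
rewrite -ltnS -(size_XnsubC a p0) adjoin_degree_le ?orbT //.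
- by rewrite -size_poly_eq0 size_XnsubC.
- by rewrite rpredB ?rpredX ?polyOverX ?polyOverC.
- by rewrite /root !hornerE xp subrr.
Qed.

(** Compare the exponents of q in numerator and denominator. *)
Lemma rat_pow_logn p q (r : rat) B : prime q -> (0 < B)%N ->
  `|r| ^+ p = B%:R -> (p %| logn q B)%N.
Proof.
move=> pq B0 rp; have k0 := denq_gt0 r.
pose m := `|numq r|%N; pose k := `|denq r|%N.
have rE : `|r| = m%:R / k%:R.
  rewrite -{1}[r]divq_num_den normrM normfV -!intr_norm -!abszE.
  by rewrite -!pmulrn.
have k_gt0 : (0 < k)%N by rewrite absz_gt0 gt_eqF.
have mk : (m ^ p = B * k ^ p)%N.
  apply/eqP; rewrite -(eqr_nat rat) natrM !natrX -rp rE expr_div_n divfK //.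
  by rewrite expf_neq0 // pnatr_eq0 -lt0n.
have := congr1 (logn q) mk; rewrite lognM ?expn_gt0 ?k_gt0 // !lognX => mkE.
by rewrite -(@dvdn_addl (p * logn q k)) ?dvdn_mulr // -mkE dvdn_mulr.
Qed.

(** The constant coefficient of the minimal polynomial of y is up to sign a
    product of d conjugates, d being the degree, and the p-th power of each
    conjugate is A. So a rational number has the p-th power +- A^d, and
    comparing exponents of q shows that p divides d. *)
Lemma nonpower_adjoin_degree (E : splittingFieldType rat) p (y : E) A q :
  prime p -> prime q -> y ^+ p = A%:R -> logn q A = 1%N -> (p <= adjoin_degree 1 y)%N.
Proof.
move=> pp pq yp qA.
have p0 := prime_gt0 pp.
have A0 : (0 < A)%N by case: A qA {yp} => //; rewrite logn0.
set d := adjoin_degree 1 y.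
have [rs /eqP rsE] := splitting_field_normal 1%AS y.
have d_rs : d = size rs.
  by apply: succn_inj; rewrite -size_minPoly rsE (size_prod_XsubC _ id).
have rsp : {in rs, forall r, r ^+ p = A%:R}.
  move=> r rrs; apply/eqP; rewrite -subr_eq0.
  suff : root ('X^p - A%:R%:P) r by rewrite /root !hornerE.
  apply: (@root_dvdp _ (minPoly 1 y)); last by rewrite rsE root_prod_XsubC.
  apply: minPoly_dvdp; last by rewrite /root !hornerE yp subrr.
  by rewrite rpredB ?rpredX ?polyOverX ?polyOverC ?rpred_nat.
have /vlineP[r rE] : (minPoly 1 y)`_0 \in 1%VS by apply: polyOverP; exact: minPolyOver.
have rp : ((-1) ^+ d * r) ^+ p = (A ^ d)%:R.
  apply: (fmorph_inj (in_alg E)); rewrite rmorphXn rmorphM rmorph_sign rmorph_nat /=.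
  rewrite -rE -horner_coef0 rsE horner_prod d_rs.
  under eq_bigr => a _ do rewrite hornerXsubC sub0r -mulN1r.
  rewrite big_split /= big_const_seq count_predT iter_mulr_1 mulrA -expr2 sqrr_sign mul1r.
  rewrite -prodrXl natrX -[in RHS](count_predT rs) -iter_mulr_1 -big_const_seq.
  by apply: eq_big_seq => a; exact: rsp.
have : (p %| logn q (A ^ d))%N.
  apply: (@rat_pow_logn p q ((-1) ^+ d * r)) => //; first by rewrite expn_gt0 A0.
  by rewrite -normrX rp normr_nat.
by rewrite lognX qA muln1 => /dvdn_leq; apply.
Qed.

Section KummerStep.
Variables (E : splittingFieldType rat) (p : nat) (z : E).
Hypotheses (pp : prime p) (pz : p.-primitive_root z).
Let p0 := prime_gt0 pp.

Lemma galois_rat (K : {subfield E}) : galois K {:E}.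
Proof.
rewrite /galois subvf normalFieldf andbT /=; apply/separableP => y _.
apply: pcharf0_separable => q; rewrite (fmorph_pchar (in_alg E)).
exact: pchar_num.
Qed.

Lemma radical_conjugate (K : {subfield E}) (g : gal_of {:E}) x a :
  g \in 'Gal({:E} / K)%g -> a \in K -> x ^+ p = a -> exists i, g x = z ^+ i * x.
Proof.
move=> gG aK xp; have [x0|x0] := eqVneq x 0.
  by exists 0%N; rewrite x0 rmorph0 mulr0.
have [|i gE] := prim_rootP pz (_ : (g x / x) ^+ p = 1).
  rewrite expr_div_n -rmorphXn /= xp (fixed_gal (subvf K) gG aK) divff // -xp.
  exact: expf_neq0.
by exists i; rewrite -gE divfK.
Qed.

Lemma galX_radical (g : gal_of {:E}) x i k : g z = z -> g x = z ^+ i * x ->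
  (g ^+ k)%g x = z ^+ (i * k) * x.
Proof.
move=> gz gx; elim: k => [|k IH]; first by rewrite muln0 mul1r gal_id.
by rewrite expgSr galM ?memvf // IH rmorphM rmorphXn /= gx gz mulrA -exprD mulnS addnC.
Qed.

(** Some automorphism over K moves al. It multiplies al by a nontrivial p-th
    root of unity, and because p is prime a power of it multiplies al by z. *)
Lemma kummer_shift (K : {subfield E}) al a : z \in K -> a \in K -> al ^+ p = a ->
  al \notin K -> exists2 g, g \in 'Gal({:E} / K)%g & g al = z * al.
Proof.
move=> zK aK alp; rewrite -{1}(galois_fixedField (galois_rat K)) => alK.
have [g gG gal] : exists2 g, g \in 'Gal({:E} / K)%g & g al != al.
  apply/exists_inP; apply: contraR alK; rewrite negb_exists_in => /forall_inP h.
  by apply/(fixedFieldP (memvf _)) => g /h; rewrite negbK => /eqP.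
have gz := fixed_gal (subvf K) gG zK.
have [i gi] := radical_conjugate gG aK alp.
have co : coprime i p.
  rewrite coprime_sym prime_coprime //; apply: contra gal => /dvdnP[k ik].
  by rewrite gi ik mulnC exprM (prim_expr_order pz) expr1n mul1r.
have [k ik] : exists k, (i * k = 1 %[mod p])%N.
  have i0 : (0 < i)%N by case: i co {gi} => //; rewrite /coprime gcd0n gtn_eqF // prime_gt1.
  case: (egcdnP p i0) => k l klE _; exists k.
  by rewrite mulnC klE (eqP co) modnMDl.
exists (g ^+ k)%g; first exact: fingroup.groupX.
by rewrite (galX_radical k gz gi) -(prim_expr_mod pz) ik modn_small ?prime_gt1.
Qed.

(** Let g send al to z al. Since g multiplies x by a root of unity, it fixes
    x al^e for a suitable e. Every other automorphism over K agrees on K(al)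
    with a power of g, so it fixes x al^e too. *)
Lemma kummer_descent (K : {subfield E}) al a x b : z \in K -> a \in K -> b \in K ->
  al ^+ p = a -> al \notin K -> x \in <<K; al>>%VS -> x ^+ p = b ->
  exists e, x * al ^+ e \in K.
Proof.
move=> zK aK bK alp alK xKa xp.
have [g gG gal] := kummer_shift zK aK alp alK.
have gz := fixed_gal (subvf K) gG zK.
have [i gi] := radical_conjugate gG bK xp.
exists (i * p.-1)%N; set y := _ * _.
have yKa : y \in <<K; al>>%VS by rewrite rpredM // rpredX // memv_adjoin.
have gy : g y = y.
  rewrite /y rmorphM rmorphXn /= gi gal exprMn mulrACA -exprD.
  by rewrite -mulnS prednK // mulnC exprM (prim_expr_order pz) expr1n mul1r.
have gky k : (g ^+ k)%g y = y.
  by elim: k => [|k IH]; rewrite ?gal_id // expgSr galM ?memvf // IH.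
have <- := galois_fixedField (galois_rat K).
apply/(fixedFieldP (memvf _)) => h hG.
have [k hk] := radical_conjugate hG aK alp.
rewrite -[RHS](gky k).
have [f fK ->] := Fadjoin_polyP yKa.
have gkG : (g ^+ k)%g \in 'Gal({:E} / K)%g by exact: (@fingroup.groupX _ _ g k gG).
rewrite -!horner_map /= !(fixedPoly_gal (subvf K) _ fK) // hk.
by rewrite (@galX_radical _ _ 1%N k gz) ?expr1 // mul1n.
Qed.
End KummerStep.

(** * Discriminants of Kummer towers *)

Section KummerTower.
Variables (E : splittingFieldType rat) (iota : {rmorphism E -> algC}) (p : nat) (z : E).
Hypotheses (pp : prime p) (pz : p.-primitive_root z).
Let p0 := prime_gt0 pp.

(** The data from which the discriminant of an order of K is computed: n
    algebraic integers b of K and n embeddings s. The third condition bounds the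
    absolute value of the discriminant of b by C^n; the last one computes the norm of
    z - 1, and is needed because the blocks of the next layer are divided by
    powers of the conjugates of z - 1. *)
Definition order_system (K : {subfield E}) n C (s : nat -> {rmorphism E -> algC}) (b : nat -> E) :=
  [/\ forall k, (k < n)%N -> b k \in K /\ algebraic_integer (b k),
      ndet n (fun i j => s i (b j)) != 0,
      `|ndet n (fun i j => s i (b j))| ^+ 2 <= (C ^ n)%:R
    & \prod_(x < n) `|s x (z - 1)| ^+ p.-1 = (p ^ n)%:R].

(** K is an extension of Q(z) by p-th roots of the primes of qs. The field
    [level_pow] is what remains of Kummer theory: up to a factor composed of
    primes of qs, a natural number that is a p-th power in K is already one in
    Q(z). It keeps the p-th root of any further prime out of K. The degree
    is only bounded from above here; the nonvanishing determinant of the system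
    supplies the other inequality. *)
Record kummer_level (K : {subfield E}) (qs : seq nat) n C : Prop := KummerLevel {
  level_z : z \in K;
  level_dim : (\dim K <= n)%N;
  level_pow : forall x a, (0 < a)%N -> x \in K -> x ^+ p = a%:R -> exists2 m,
    (0 < m)%N /\ (forall q, prime q -> q \notin qs -> ~~ (q %| m)%N) &
    exists2 y, y \in <<1; z>>%VS & y ^+ p = (a * m)%:R;
  level_order : exists s b, order_system K n C s b }.

Lemma z_neq1 : z - 1 != 0.
Proof.
rewrite subr_eq0; apply: contraTneq pz => ->.
by apply/negP => /prim_order_dvd/(_ 1%N); rewrite expr1 eqxx dvdn1 gtn_eqF ?prime_gt1.
Qed.

Lemma adjoin_degree_unity : (adjoin_degree 1 z < p)%N.
Proof.
have sz : size (\poly_(i < p) (1 : E)) = p by rewrite size_poly_eq ?oner_neq0.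
rewrite -[ltnRHS]sz adjoin_degree_le //.
- by rewrite -size_poly_eq0 sz -lt0n.
- by apply/polyOverP => i; rewrite coef_poly; case: ifP; rewrite ?rpred1 ?rpred0.
rewrite /root horner_poly; apply/eqP/(mulfI z_neq1); rewrite mulr0.
under eq_bigr => i _ do rewrite mul1r.
by rewrite -subrX1 (prim_expr_order pz) subrr.
Qed.

(** By [nonpower_adjoin_degree] y would have degree at least p, whereas the degree
    of Q(z) is less than p. *)
Lemma unity_nonpower y a q : prime q -> y \in <<1; z>>%VS -> y ^+ p = a%:R ->
  logn q a != 1%N.
Proof.
move=> pq yK ya; apply/eqP => qa.
have := nonpower_adjoin_degree pp pq ya qa; rewrite leqNgt => /negP; apply.
apply: leq_ltn_trans adjoin_degree_unity.
have dimE t : \dim <<1; t>> = adjoin_degree 1 t by rewrite (dim_Fadjoin 1%AS) dimv1 muln1.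
rewrite -!dimE.
by apply: dimvS; rewrite sub_adjoin1v.
Qed.

Lemma level_notin K qs n C al q : kummer_level K qs n C -> prime q -> q \notin qs ->
  al ^+ p = q%:R -> al \notin K.
Proof.
move=> lv pq qqs alq; apply/negP => alK.
have [m [m0 mqs] [y yK ym]] := level_pow lv (prime_gt0 pq) alK alq.
have /negP := unity_nonpower pq yK ym; apply.
have q0 := prime_gt0 pq.
rewrite lognM // logn_prime // eqxx lognE pq m0 (negbTE (mqs _ pq qqs)) //.
Qed.

Lemma ltn_div_mod n k : (k < n * p)%N -> (k %/ p < n)%N /\ (k %% p < p)%N.
Proof. by move=> kn; rewrite ltn_divLR // ltn_pmod. Qed.

Lemma prod_div_mod (R : comPzRingType) n (F : nat -> nat -> R) :
  \prod_(k < n * p) F (k %/ p)%N (k %% p)%N = \prod_(x < n) \prod_(y < p) F x y.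
Proof.
elim: n F => [|n IH] F; first by rewrite !big_ord0.
rewrite big_ord_recl -(IH (fun x => F x.+1)) (@big_split_ord _ _ _ p (n * p)); congr (_ * _).
  by apply: eq_bigr => i _ /=; rewrite divn_small // modn_small.
by apply: eq_bigr => i _ /=; rewrite divnDl ?dvdnn // divnn p0 modnDl.
Qed.

(** Put th = (al - c) / pi. If the automorphism g sends al to z al, the conjugates
    of th over K are (z^y al - c) / pi, so their differences are
    al (z^i - z^j) / pi and the square of their Vandermonde determinant has
    absolute value q^(p-1) p^p / |pi|^(p (p-1)). Multiplying over the n
    embeddings of K replaces |pi|^(p-1) by P^n, which gives the factor
    C q p / P. The choice pi = 1 keeps the factor p, the choice pi = z - 1
    cancels it. *)
Lemma level_step K qs n C al q pi c P C' : kummer_level K qs n C ->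
  prime q -> q \notin qs -> al ^+ p = q%:R -> pi \in K -> c \in K -> pi != 0 ->
  algebraic_integer ((al - c) / pi) ->
  (forall s b, order_system K n C s b -> \prod_(x < n) `|s x pi| ^+ p.-1 = (P ^ n)%:R) ->
  (C * q * p <= C' * P)%N ->
  kummer_level <<K; al>>%AS (q :: qs) (n * p) C'.
Proof.
move=> lv pq qqs alq piK cK pi0 thi piP CC'.
have alK := level_notin lv pq qqs alq.
have zK := level_z lv.
have natK m : m%:R \in K by rewrite rpred_nat.
have [g gG gal] := kummer_shift pp pz zK (natK q) alq alK.
have gz := fixed_gal (subvf K) gG zK.
have KKa : (K <= <<K; al>>)%VS by exact: subv_adjoin.
split.
- exact: (subvP KKa).
- apply: leq_trans (dim_Fadjoin_le p0 (natK q) alq) _.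
  by rewrite leq_mul2r (level_dim lv) orbT.
- move=> x a a0 xK xa.
  have [e xeK] := kummer_descent pp pz zK (natK q) (natK a) alq alK xK xa.
  have aq0 : (0 < a * q ^ e)%N by rewrite muln_gt0 a0 expn_gt0 prime_gt0.
  have [|m [m0 mqs] my] := level_pow lv aq0 xeK.
    by rewrite exprMn xa exprAC alq natrM natrX.
  exists (q ^ e * m)%N; last by rewrite mulnA.
  split; first by rewrite muln_gt0 expn_gt0 prime_gt0.
  move=> r pr; rewrite inE negb_or => /andP[rq rqs].
  rewrite Euclid_dvdM // negb_or mqs // andbT.
  by rewrite Euclid_dvdX // negb_and dvdn_prime2 ?rq.
have [s [b sb]] := level_order lv; have [bK bdet bC bz] := sb.
have pinorm := piP _ _ sb.
pose th := (al - c) / pi.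
pose G y := (g ^+ y)%g : {rmorphism E -> E}.
pose s' k : {rmorphism E -> algC} := (s (k %/ p)%N) \o (G (k %% p)%N).
pose b' k := b (k %/ p)%N * th ^+ (k %% p)%N.
have GK y x : x \in K -> G y x = x.
  by move=> xK; apply: (fixed_gal (subvf K) _ xK); exact: fingroup.groupX.
have Gal y : G y al = z ^+ y * al.
  by rewrite /G /= (@galX_radical _ _ _ _ 1%N y gz) ?expr1 // mul1n.
have Gth y : G y th = (z ^+ y * al - c) / pi.
  by rewrite /th fmorph_div rmorphB Gal !GK.
pose B x i j := (s x (G i th)) ^+ j.
have detE : ndet (n * p) (fun i j => s' i (b' j)) =
    ndet n (fun i j => s i (b j)) ^+ p * \prod_(x < n) ndet p (B x).
  rewrite -ndet_relative //; apply: eq_ndet => i j ip jp.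
  have [jn _] := ltn_div_mod jp.
  rewrite /= /b' rmorphM rmorphM rmorphXn rmorphXn /=.
  by rewrite (GK _ _ (bK _ jn).1).
have wz x : p.-primitive_root (s x z) by rewrite fmorph_primitive_root.
have Bdet x : `|ndet p (B x)| ^+ 2 * (`|s x pi| ^+ p.-1) ^+ p = (q ^ p.-1 * p ^ p)%:R.
  rewrite (ndet_Vandermonde p (fun i => s x (G i th))) (norm_prod_offdiag p (fun i => s x (G i th))).
  have fE (i j : nat) : `|s x (G i th) - s x (G j th)| =
      `|s x al| / `|s x pi| * `|s x z ^+ i - s x z ^+ j|.
    rewrite -rmorphB !Gth -mulrBl opprB addrA subrK -mulrBl.
    rewrite fmorph_div rmorphM rmorphB !rmorphXn normf_div normrM -mulrA; ring.
  rewrite [X in X * _](_ : _ = ((`|s x al| / `|s x pi|) ^+ p.-1) ^+ p * (p ^ p)%:R); last first.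
    rewrite -(norm_disc_unity (wz x)) -[X in _ ^+ X * _](card_ord p) -prodr_const -big_split /=.
    apply: eq_bigr => i _; under eq_bigr => j _ do rewrite fE.
    rewrite big_split /=; congr (_ * _).
    rewrite prodr_const; congr (_ ^+ _).
    rewrite (eq_card (_ : _ =i predC1 i)); first by rewrite cardC1 card_ord.
    by move=> j; rewrite !inE.
  have pin0 : `|s x pi| != 0 by rewrite normr_eq0 fmorph_eq0.
  rewrite mulrAC -exprMn -exprMn divfK // exprAC -normrX -rmorphXn alq rmorph_nat normr_nat.
  by rewrite natrM !natrX.
have pipos (x : nat) : 0 < (`|s x pi| ^+ p.-1) ^+ p.
  by rewrite !exprn_gt0 // normr_gt0 fmorph_eq0.
have prodB : `|\prod_(x < n) ndet p (B x)| ^+ 2 * (P ^ (n * p))%:R = (q ^ p.-1 * p ^ p)%:R ^+ n.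
  rewrite normr_prod -prodrXl expnM natrX -pinorm -prodrXl -big_split /=.
  under eq_bigr => x _ do rewrite Bdet.
  by rewrite prodr_const card_ord.
have Ppos : 0 < (P ^ (n * p))%:R :> algC.
  rewrite expnM natrX -pinorm -prodrXl; apply: prodr_gt0 => x _; exact: pipos.
exists s', b'; split.
- move=> k /ltn_div_mod[kn _]; have [bkK bki] := bK _ kn; split.
    have piKa := subvP KKa _ piK; have cKa := subvP KKa _ cK.
    have bKa := subvP KKa _ bkK; have alKa : al \in <<K; al>>%VS := memv_adjoin _ _.
    by rewrite rpredM // rpredX // rpredM ?rpredV ?rpredB.
  by apply: algint_mul => //; apply: algint_exp.
- rewrite detE mulf_neq0 ?expf_neq0 //.
  have := congr1 (fun t => t == 0) prodB; rewrite mulf_eq0 (gt_eqF Ppos) orbF.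
  rewrite expf_eq0 normr_eq0 /= => ->; rewrite -natrX pnatr_eq0 -lt0n.
  by rewrite expn_gt0 muln_gt0 !expn_gt0 p0 prime_gt0.
- rewrite detE normrM normrX exprMn -(ler_pM2r Ppos) -mulrA prodB exprAC.
  apply: (@le_trans _ _ ((C ^ n)%:R ^+ p * (q ^ p.-1 * p ^ p)%:R ^+ n)).
    by rewrite ler_wpM2r ?exprn_ge0 // lerXn2r ?nnegrE ?exprn_ge0 // normr_ge0.
  rewrite -!natrX -!natrM ler_nat.
  apply: leq_trans (_ : (C * q * p) ^ (n * p) <= _)%N; last first.
    by rewrite -expnMn; case: (posnP (n * p)) => [->|np0] //; rewrite leq_exp2r.
  rewrite -expnM !expnMn -!expnM -mulnA leq_mul2l; apply/orP; right.
  rewrite (mulnC p n) leq_mul2r; apply/orP; right.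
  by rewrite leq_pexp2l ?prime_gt0 // mulnC leq_mul2l leq_pred orbT.
rewrite (eq_bigr (fun k : 'I_(n * p) => `|s (k %/ p)%N (z - 1)| ^+ p.-1)) => [|k _].
  rewrite (prod_div_mod n (fun x _ => `|s x (z - 1)| ^+ p.-1)).
  under eq_bigr => x _ do rewrite prodr_const card_ord.
  by rewrite prodrXl bz -natrX -expnM.
by rewrite /= (GK _ (z - 1)) // rpredB ?rpred1.
Qed.

(** The powers of z up to the exponent p - 2 have the discriminant p^(p-2)
    up to sign. *)
Lemma level_base : kummer_level <<1; z>>%AS [::] p.-1 p.
Proof.
split.
- exact: memv_adjoin.
- have -> : \dim <<1; z>> = adjoin_degree 1 z by rewrite (dim_Fadjoin 1%AS) dimv1 muln1.
  by rewrite -ltnS prednK // adjoin_degree_unity.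
- move=> x a a0 xK xa; exists 1%N; last by exists x; rewrite // muln1.
  by split=> // q pq _; rewrite dvdn1 gtn_eqF // prime_gt1.
pose w := iota z.
have pw : p.-primitive_root w by rewrite fmorph_primitive_root.
have /choice[s sE] (t : nat) : exists f : {rmorphism E -> algC}, (t < p.-1)%N -> f z = w ^+ t.+1.
  have [co|nco] := boolP (coprime t.+1 p).
    have [f fE] := Qn_aut_exists co; exists (f \o iota) => _ /=.
    by rewrite fE // (prim_expr_order pw).
  exists iota => tp; case/negP: nco; rewrite coprime_sym prime_coprime // gtnNdvd //.
  by rewrite -(prednK p0) ltnS.
exists s, (fun j => z ^+ j).
have np : (p.-1.+1 = p)%N by rewrite prednK.
have prod1 : \prod_(x < p.-1) `|1 - w ^+ x.+1| = p%:R.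
  by rewrite -normr_prod prod_root_unity_sub1 // normr_nat.
have detE : ndet p.-1 (fun i j => s i (z ^+ j)) = ndet p.-1 (fun i j => (w ^+ i.+1) ^+ j).
  by apply: eq_ndet => i j ip jp; rewrite rmorphXn sE.
have det2 : `|ndet p.-1 (fun i j => s i (z ^+ j))| ^+ 2 * p%:R = (p ^ p.-1)%:R.
  rewrite detE (ndet_Vandermonde _ (fun i => w ^+ i.+1)) (norm_prod_offdiag _ (fun i => w ^+ i.+1)).
  rewrite -[X in _ * X]prod1 -big_split natrX -[X in _ ^+ X](card_ord p.-1) -prodr_const.
  apply: eq_bigr => i _; have ip : (i.+1 < p)%N by rewrite -[ltnRHS]np ltnS.
  have := congr1 Num.norm (prod_root_unity_diff pw ip).
  rewrite normrM normr_nat (normrX (i.+1 * _)).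
  have -> : `|w| = 1.
    apply/eqP; rewrite -(pexpr_eq1 p0) // -normrX.
    by rewrite (prim_expr_order pw) normr1.
  rewrite expr1n mulr1 => <-; rewrite normr_prod /= mulrC.
  have split0 m (F : nat -> algC) : m = p.-1.+1 ->
      \prod_(j < m | j != i.+1 :> nat) F j = F 0%N * \prod_(j < p.-1 | j != i :> nat) F j.+1.
    move=> ->; rewrite big_mkcond big_ord_recl /=; congr (_ * _).
    by rewrite [RHS]big_mkcond; apply: eq_bigr => j _; rewrite /bump /= add1n eqSS.
  by rewrite (split0 p (fun j => `|w ^+ i.+1 - w ^+ j|)) // expr0 distrC.
split.
- move=> k _; split; first by rewrite rpredX // memv_adjoin.
  by apply: algint_exp; apply: (algint_root_nat p0 (prim_expr_order pz : _ = 1%:R)).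
- have := congr1 (fun t => t == 0) det2; rewrite mulf_eq0 pnatr_eq0 expf_eq0 normr_eq0 /=.
  by rewrite pnatr_eq0 expn_eq0 (gtn_eqF p0) /= orbF => ->.
- rewrite -det2 ler_peMr ?exprn_ge0 ?normr_ge0 //.
  by rewrite ler1n.
rewrite prodrXl natrX; congr (_ ^+ _); rewrite -prod1; apply: eq_bigr => x _.
by rewrite rmorphB rmorph1 sE // distrC.
Qed.

(** Congruence modulo p^2 is the precision that makes [algint_unity_quotient]
    applicable. *)
Definition near_power (K : {subfield E}) (a : nat) :=
  exists2 c, c \in K /\ algebraic_integer c & exists v : nat, c ^+ p = (a + p ^ 2 * v)%:R.

Lemma level_step_unramified K qs n C al q : kummer_level K qs n C ->
  prime q -> q \notin qs -> al ^+ p = q%:R -> near_power K q ->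
  kummer_level <<K; al>>%AS (q :: qs) (n * p) (C * q).
Proof.
move=> lv pq qqs alq [c [cK ci] [v cp]].
apply: (level_step (pi := z - 1) (c := c) (P := p) lv) => //.
- by rewrite rpredB ?rpred1 ?(level_z lv).
- exact: z_neq1.
- apply: (algint_unity_quotient pp pz alq ci (algint_nat E v)).
  by rewrite cp natrD natrM natrX.
- by move=> s b [].
Qed.

Lemma level_step_ramified K qs n C al q : kummer_level K qs n C ->
  prime q -> q \notin qs -> al ^+ p = q%:R ->
  kummer_level <<K; al>>%AS (q :: qs) (n * p) (C * q * p).
Proof.
move=> lv pq qqs alq.
apply: (level_step (pi := 1) (c := 0) (P := 1%N) lv) => //.
- exact: rpred1.
- exact: rpred0.
- exact: oner_neq0.
- by rewrite subr0 divr1; exact: (algint_root_nat p0 alq).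
- move=> s b _; rewrite exp1n big1 // => i _; by rewrite rmorph1 normr1 expr1n.
by rewrite muln1.
Qed.

Lemma level_unramified_tower K qs n C (al : nat -> E) ls : kummer_level K qs n C ->
  uniq ls -> {in ls, forall q, [/\ prime q, q \notin qs, al q ^+ p = q%:R & near_power K q]} ->
  exists (K' : {subfield E}) qs', [/\ (K <= K')%VS, {in ls, forall q, al q \in K'} &
    kummer_level K' qs' (n * p ^ size ls) (C * \prod_(q <- ls) q)].
Proof.
elim: ls K qs n C => [|q ls IH] K qs n C lv /=.
  by move=> _ _; exists K, qs; rewrite subvv big_nil !muln1.
case/andP => qls uls h.
have [pq qqs alq nq] := h q (mem_head _ _).
have lv' := level_step_unramified lv pq qqs alq nq.
have [|K' [qs' [KK' alK' lvK']]] := IH _ _ _ _ lv' uls.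
  move=> r rls; have [|pr rqs alr [c [cK ci] cv]] := h r; first by rewrite inE rls orbT.
  split=> //; first by rewrite inE negb_or rqs andbT; apply: contraNneq qls => <-.
  by exists c => //; split=> //; apply: subvP cK; exact: subv_adjoin.
exists K', qs'; split.
- exact: subv_trans (subv_adjoin _ _) KK'.
- move=> r; rewrite inE => /predU1P[->|]; last exact: alK'.
  by apply: (subvP KK'); exact: memv_adjoin.
by rewrite big_cons expnS !mulnA.
Qed.
End KummerTower.

(** Modulo p^2 the residues congruent to 1 modulo p form a group of order p,
    which q0^(p-1) generates unless it is trivial. Hence a^(1-p) is a power of
    q0^(p-1). *)
Lemma pow_near_power p q0 a v : prime p -> (0 < a < p)%N ->
  (q0 ^ p.-1 = 1 + p * v)%N -> ~~ (p %| v)%N ->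
  exists k w, (a ^ p * (q0 ^ (p.-1 * k)) = a + p ^ 2 * w)%N.
Proof.
move=> pp /andP[a0 ap] q0E pv; have p0 := prime_gt0 pp.
have [u uE] : exists u, (a ^ p = a + p * u)%N.
  have /eqP := fermat_little a pp; rewrite eqn_mod_dvd; last by rewrite -{1}[a]expn1 leq_pexp2l.
  case/dvdnP => u uE; exists u; rewrite mulnC -uE subnKC //.
  by rewrite -{1}[a]expn1 leq_pexp2l.
have co : coprime (a * v) p.
  by rewrite coprimeMl !(coprime_sym _ p) !prime_coprime // pv andbT gtnNdvd.
have av0 : (0 < a * v)%N by rewrite muln_gt0 a0 lt0n; apply: contraNneq pv => ->.
have [k [l kE]] : exists k l, (u + a * v * k = p * l)%N.
  case: (egcdnP p av0) => k l klE _.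
  exists (k * (p.-1 * u))%N, (u + l * (p.-1 * u))%N.
  rewrite (eqP co) in klE.
  have -> : (a * v * (k * (p.-1 * u)) = k * (a * v) * (p.-1 * u))%N by ring.
  have pu : (p * u = u + p.-1 * u)%N by rewrite -mulSn prednK.
  by rewrite klE mulnDr pu; ring.
have [t tE] : exists t, ((1 + p * v) ^ k = 1 + k * (p * v) + p ^ 2 * t)%N.
  elim: (k) => [|m [t IH]]; first by exists 0%N; rewrite muln0.
  exists (t * (1 + p * v) + m * v ^ 2)%N; rewrite expnS IH; ring.
exists k, (l + u * k * v + (a + p * u) * t)%N.
rewrite expnM q0E uE tE.
have -> : ((a + p * u) * (1 + k * (p * v) + p ^ 2 * t) =
  a + p * (u + a * v * k) + p ^ 2 * (u * k * v + (a + p * u) * t))%N by ring.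
rewrite kE; ring.
Qed.

(** If q^p = q modulo p^2 for all q in qs, then all the radicals can be adjoined
    without ramification above p. Otherwise adjoin first the radical of some q0
    for which this fails. By [pow_near_power] every other q is then congruent
    modulo p^2 to the p-th power of q (al q0)^((p-1) k). In both cases the
    n algebraic integers of the last level have nonzero determinant, so that
    n <= [E : Q], and they form a basis. *)
Theorem kummer_field_disc (E : splittingFieldType rat) (iota : {rmorphism E -> algC})
    p (z : E) (al : nat -> E) qs :
  prime p -> p.-primitive_root z -> uniq qs ->
  {in qs, forall q, [/\ prime q, (q < p)%N & al q ^+ p = q%:R]} ->
  <<1 & z :: map al qs>>%VS = {:E}%VS ->
  \dim {:E} = (p.-1 * p ^ size qs)%N /\
  exists2 D, is_absdisc E D & D <= ((p ^ 2 * \prod_(q <- qs) q) ^ \dim {:E})%:R.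
Proof.
move=> pp pz uqs qsP genE; have p0 := prime_gt0 pp.
suff [K [ls [C [zK [alK [C_le lv]]]]]] : exists (K : {subfield E}) ls C,
  z \in K /\ {in qs, forall q, al q \in K} /\ (C <= p ^ 2 * \prod_(q <- qs) q)%N /\
  kummer_level p z K ls (p.-1 * p ^ size qs) C.
  have KE : K = {:E}%AS.
    apply/eqP; rewrite -val_eqE eqEsubv subvf /= -genE; apply/Fadjoin_seqP; split.
      exact: sub1v.
    by move=> x; rewrite inE => /predU1P[->|/mapP[q qqs ->]] //; exact: alK.
  have [s [b [bK bdet bC _]]] := level_order lv.
  have := level_dim lv; rewrite KE /= => dimle.
  set n := (_ * _)%N in bK bdet bC dimle *.
  have dimE : \dim {:E} = n.
    apply/eqP; rewrite eqn_leq dimle /=.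
    have fb : free [tuple b i | i < n].
      apply: (@embedding_mx_free _ _ (fun i => s i)); apply: contra bdet => /eqP d0.
      apply/eqP; rewrite -[RHS]d0; congr (\det _); apply/matrixP => i j.
      by rewrite !mxE -tnth_nth tnth_mktuple.
    rewrite -[leqLHS](size_tuple [tuple b i | i < n]) -(eqnP fb).
    by apply: dimvS; rewrite subvf.
  split=> //; move: bK bdet bC; rewrite -dimE => bK bdet bC.
  pose B := [tuple b i | i < \dim {:E}].
  have BE (i : 'I_(\dim {:E})) : B`_i = b i by rewrite -tnth_nth tnth_mktuple.
  have SB : embedding_mx (fun i : 'I_(\dim {:E}) => s i) (fun j => B`_j) =
      \matrix_(i < \dim {:E}, j < \dim {:E}) s i (b j).
    by apply/matrixP => i j; rewrite !mxE BE.
  have [|i|D DE Dle] := @absdisc_exists E (fun i => s i) B.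
  - by rewrite SB.
  - by rewrite BE; exact: (bK i (ltn_ord i)).2.
  exists D => //; rewrite -(ler_rat algC) ratr_nat; apply: le_trans Dle _.
  rewrite SB; apply: le_trans bC _; rewrite ler_nat.
  by rewrite leq_exp2r // (adim_gt0 {:E}%AS).
have lv0 := level_base iota pp pz.
have pE q : q \in qs -> coprime q p.
  by case/qsP => pq qp _; rewrite coprime_sym prime_coprime // gtnNdvd ?prime_gt0.
have q_fermat q : q \in qs -> exists v, (q ^ p.-1 = 1 + p * v)%N.
  move=> qqs; have := Euler_exp_totient (pE _ qqs); rewrite totient_prime // => /eqP.
  rewrite eqn_mod_dvd ?expn_gt0; last by case: (qsP _ qqs) => /prime_gt0 ->.
  case/dvdnP => v vE; exists v; rewrite mulnC -vE subnKC // expn_gt0.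
  by case: (qsP _ qqs) => /prime_gt0 ->.
pose wieferich q := (p ^ 2 %| q ^ p.-1 - 1)%N.
have [wie|] := boolP (all wieferich qs).
  have [|K [ls [KK alK lv]]] := level_unramified_tower (al := al) pp pz lv0 uqs.
    move=> q qqs; have [pq qp alq] := qsP q qqs; split=> //.
    have /dvdnP[v vE] := allP wie q qqs.
    exists q%:R; first by split; [exact: rpred_nat | exact: algint_nat].
    exists (q * v)%N; rewrite -natrX; congr (_%:R).
    have : (q ^ p.-1 = 1 + v * p ^ 2)%N.
      by rewrite -vE subnKC // expn_gt0 prime_gt0.
    have -> : (q ^ p = q * q ^ p.-1)%N by rewrite -expnS prednK.
    by move=> ->; ring.
  exists K, ls, (p * \prod_(q <- qs) q)%N; split; first exact: level_z lv.
  by split=> //; split=> //; rewrite leq_mul2r -{1}[p]expn1 leq_pexp2l ?orbT.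
case/allPn => q0 q0qs nwie.
have [pq0 q0p alq0] := qsP q0 q0qs.
have [v vE] := q_fermat q0 q0qs.
have pv : ~~ (p %| v)%N.
  apply: contra nwie => /dvdnP[k vk]; rewrite /wieferich vE addKn vk.
  by rewrite mulnCA dvdn_mull // -mulnn.
have lv1 := level_step_ramified pp pz lv0 pq0 (isT : q0 \notin [::]) alq0.
have perm_qs : perm_eq qs (q0 :: rem q0 qs) by exact: perm_to_rem.
have [||K [ls [KK alK lv]]] := level_unramified_tower (al := al) (ls := rem q0 qs) pp pz lv1.
- exact: rem_uniq.
- move=> q qr; have qqs := mem_rem qr; have [pq qp alq] := qsP q qqs; split=> //.
    by rewrite inE; move: qr; rewrite mem_rem_uniq // inE => /andP[].
  have [|k [w kw]] := @pow_near_power p q0 q v pp _ vE pv; first by rewrite prime_gt0.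
  have al0K : al q0 \in <<<<1; z>>; al q0>>%AS by exact: memv_adjoin.
  exists (q%:R * al q0 ^+ (p.-1 * k)).
    split; first by rewrite rpredM ?rpred_nat ?rpredX.
    apply: algint_mul; first exact: algint_nat.
    by apply: algint_exp; exact: (algint_root_nat p0 alq0).
  by exists w; rewrite exprMn exprAC alq0 -!natrX -natrM kw.
exists K, ls, (p * q0 * p * \prod_(q <- rem q0 qs) q)%N; split; first exact: level_z lv.
split.
  move=> q; rewrite (perm_mem perm_qs) inE => /predU1P[->|]; last exact: alK.
  by apply: (subvP KK); exact: memv_adjoin.
rewrite (perm_big _ perm_qs) big_cons (perm_size perm_qs) /=; split.
  by apply: eq_leq; ring.
by rewrite expnS mulnA.
Qed.

(** * Splitting fields of radicals *)

Definition primes_upto N := [seq q <- iota 1 N | prime q].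

Lemma prod_radical_roots (F : fieldType) p (z b : F) : prime p -> p.-primitive_root z ->
  b != 0 -> 'X^p - (b ^+ p)%:P = \prod_(r <- [seq z ^+ i * b | i <- iota 0 p]) ('X - r%:P).
Proof.
move=> pp pz b0; have p0 := prime_gt0 pp.
set rs := map _ _.
have urs : uniq rs.
  rewrite map_inj_in_uniq ?iota_uniq // => i j; rewrite !mem_iota !add0n /= => ip jp.
  move/(mulIf b0)/eqP; rewrite (eq_prim_root_expr pz) !modn_small // => /eqP //.
have /all_roots_prod_XsubC : size ('X^p - (b ^+ p)%:P) = (size rs).+1.
  by rewrite size_XnsubC // size_map size_iota.
rewrite (monicP (monicXnsubC _ p0)) scale1r; apply; last by rewrite uniq_rootsE.
apply/allP => _ /mapP[i _ ->].
by rewrite /root !hornerE exprMn exprAC (prim_expr_order pz) expr1n mul1r subrr.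
Qed.

Lemma radical_of_primes (F : fieldType) p (al : nat -> F) N :
  (forall q, prime q -> (q <= N)%N -> al q ^+ p = q%:R) ->
  forall a, (0 < a <= N)%N -> exists b : F, b ^+ p = a%:R.
Proof.
move=> alP a; elim/ltn_ind: a => a IH /andP[a0 aN].
case: (ltngtP a 1) => [|a1|->]; [by rewrite ltnS leqNgt a0| |by exists 1; rewrite expr1n].
have dp : (pdiv a * (a %/ pdiv a))%N = a by rewrite mulnC divnK ?pdiv_dvd.
have [||b bE] := IH (a %/ pdiv a)%N.
- by rewrite ltn_Pdiv // prime_gt1 ?pdiv_prime.
- by rewrite divn_gt0 ?pdiv_gt0 // pdiv_leq //= (leq_trans (leq_div _ _)).
exists (al (pdiv a) * b); rewrite exprMn bE alP ?pdiv_prime -?natrM ?dp //.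
by rewrite (leq_trans (pdiv_leq a0)).
Qed.

(** The radicals of composite numbers are products of those of primes, so the
    splitting field is generated by z and the p-th roots of the primes up to N;
    [kummer_field_disc] applies to it. *)
Theorem radical_field_exists p N : prime p -> (0 < N < p)%N ->
  exists (E : fieldExtType rat) (D : rat),
  [/\ generated_by_roots E [seq 'X^p - a%:R%:P | a <- iota 1 N],
      \dim {:E} = (p.-1 * p ^ size (primes_upto N))%N,
      is_absdisc E D &
      D <= ((p ^ 2 * \prod_(q <- primes_upto N) q) ^ \dim {:E})%:R].
Proof.
move=> pp /andP[N0 Np]; have p0 := prime_gt0 pp; set qs := primes_upto N.
have uqs : uniq qs by rewrite filter_uniq ?iota_uniq.
have qsP q : (q \in qs) = prime q && (q <= N)%N.
  by rewrite mem_filter mem_iota add1n ltnS; case: (boolP (prime q)) => // /prime_gt0 ->.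
have [zC pzC] := C_prim_root_exists p0.
have [E [iota_ [[|z s1] // [zE s1E] genE]]] :=
  num_field_exists (zC :: [seq p.-root q%:R | q <- qs]).
have pz : p.-primitive_root z by rewrite -(fmorph_primitive_root iota_) zE.
pose al q := nth 0 s1 (index q qs).
have ss1 : size s1 = size qs by rewrite -(size_map iota_) s1E size_map.
have alE : map al qs = s1.
  apply: (@eq_from_nth _ 0); rewrite size_map ?ss1 // => i iqs.
  by rewrite (nth_map 0%N) // /al index_uniq.
have alp q : q \in qs -> al q ^+ p = q%:R.
  move=> qqs; apply: (fmorph_inj iota_); rewrite rmorphXn rmorph_nat /= /al.
  rewrite -(nth_map _ 0) ?ss1 ?index_mem // s1E (nth_map 0%N) ?index_mem //.
  by rewrite nth_index // rootCK.
have /choice[b bP] a : exists b, (0 < a <= N)%N -> b ^+ p = a%:R :> E.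
  case: (boolP (0 < a <= N)%N) => [aN|]; last by exists 0.
  have [|b bE] := @radical_of_primes E p al N _ a aN; last by exists b.
  by move=> q pq qN; apply: alp; rewrite qsP pq.
have natr_neq0 a : (0 < a)%N -> a%:R != 0 :> E.
  by move=> a0; rewrite -(fmorph_eq0 iota_) rmorph_nat pnatr_eq0 -lt0n.
pose rs := flatten [seq [seq z ^+ i * b a | i <- iota 0 p] | a <- iota 1 N].
pose P : {poly E} := \prod_(a <- iota 1 N) ('X^p - a%:R%:P).
have PE : P = \prod_(r <- rs) ('X - r%:P).
  rewrite big_flatten big_map; apply: eq_big_seq => a.
  rewrite mem_iota add1n ltnS => aN; rewrite -(bP a aN) -prod_radical_roots //.
  by apply: contraNneq (natr_neq0 a (proj1 (andP aN))) => b0; rewrite -bP // b0 expr0n gtn_eqF.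
have Proot a (x : E) : (0 < a <= N)%N -> x ^+ p = a%:R -> x \in rs.
  move=> aN xp; rewrite -root_prod_XsubC -PE /P (big_rem a) /=; last by rewrite mem_iota add1n ltnS.
  by rewrite rootM /root !hornerE xp subrr eqxx.
have gen_rs : <<1 & rs>>%VS = {:E}%VS.
  apply/eqP; rewrite eqEsubv subvf -genE; apply/Fadjoin_seqP; split; first exact: sub1v.
  move=> x; rewrite inE -alE => /predU1P[->|/mapP[q qqs ->]]; apply: seqv_sub_adjoin.
    by apply: (Proot 1%N); rewrite ?N0 // (prim_expr_order pz).
  by apply: (Proot q); [move: qqs; rewrite qsP => /andP[/prime_gt0 ->]|exact: alp].
have mapP : map_poly (in_alg E) (\prod_(f <- [seq 'X^p - a%:R%:P | a <- iota 1 N]) f) = P.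
  rewrite big_map rmorph_prod; apply: eq_bigr => a _.
  by rewrite rmorphB /= map_polyXn map_polyC /= scaler_nat.
have split_P : generated_by_roots E [seq 'X^p - a%:R%:P | a <- iota 1 N].
  by exists rs; rewrite ?mapP ?PE ?eqpxx.
have Eax : FieldExt_isSplittingField _ E.
  constructor; exists P; last by rewrite -mapP.
  apply: rpred_prod => a _.
  by rewrite rpredB ?rpredX ?polyOverX ?polyOverC ?rpred_nat.
pose E' := HB.pack_for (splittingFieldType rat) E Eax.
have [||dimE [D DE Dle]] := @kummer_field_disc E' iota_ p z al qs pp pz uqs.
- move=> q qqs; split; last exact: alp.
    by move: qqs; rewrite qsP => /andP[].
  by move: qqs; rewrite qsP => /andP[_ qN]; exact: leq_ltn_trans Np.
- by rewrite alE.
by exists E, D.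
Qed.

(** * A weak form of Chebyshev's theorem *)

Lemma expn2_le_central_bin n : (2 ^ n <= 'C(2 * n, n))%N.
Proof.
elim: n => [|n IH]; first by rewrite bin0.
have -> : (2 * n.+1 = (2 * n).+2)%N by ring.
have h1 : ('C((2 * n).+1, n.+1) = 'C((2 * n).+1, n))%N.
  rewrite -[RHS]bin_sub; last by lia.
  by congr 'C(_, _); lia.
have h2 := binS (2 * n) n.
by rewrite binS expnS; lia.
Qed.

(** By Legendre's formula the exponent of q is the sum over k of
    (2 n) / q^k - 2 (n / q^k), with rounded quotients. Each term is at most 1,
    and it vanishes once q^k > 2 n. *)
Lemma central_bin_pfactor n q : prime q -> (0 < n)%N ->
  (q ^ logn q 'C(2 * n, n) <= 2 * n)%N.
Proof.
move=> pq n0; have q1 := prime_gt1 pq.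
have n2 : (0 < 2 * n)%N by rewrite muln_gt0.
apply: leq_trans (trunc_logP q1 n2); rewrite leq_exp2l //.
set t := trunc_log q (2 * n).
have tn : (t <= 2 * n)%N.
  by apply: ltnW; apply: leq_trans (trunc_logP q1 n2); exact: ltn_expl.
have f0 m : (0 < m`!)%N by exact: fact_gt0.
have b0 : (0 < 'C(2 * n, n))%N by rewrite bin_gt0; lia.
have := congr1 (logn q) (@bin_fact (2 * n) n (ltac:(lia))).
have -> : (2 * n - n = n)%N by lia.
rewrite !lognM ?muln_gt0 ?f0 // !(logn_fact _ pq).
have ext : (\sum_(1 <= k < n.+1) n %/ q ^ k = \sum_(1 <= k < (2 * n).+1) n %/ q ^ k)%N.
  rewrite [RHS](big_cat_nat _ _ (n := n.+1)) //=; last by lia.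
  rewrite [X in (_ + X)%N]big1_seq ?addn0 // => k /andP[_]; rewrite mem_index_iota => /andP[nk _].
  by rewrite divn_small // (leq_trans nk) // ltnW // ltn_expl.
rewrite ext => vE.
have : (\sum_(1 <= k < (2 * n).+1) 2 * n %/ q ^ k <=
  \sum_(1 <= k < (2 * n).+1) (n %/ q ^ k + n %/ q ^ k) + \sum_(1 <= k < (2 * n).+1) (k <= t))%N.
  rewrite -big_split /= leq_sum // => k _.
  have qk0 : (0 < q ^ k)%N by rewrite expn_gt0 prime_gt0.
  case: (leqP k t) => [_|tk].
    rewrite addn1 -ltnS ltn_divLR //.
    have := ltn_ceil n qk0; set d := (n %/ q ^ k)%N => nd.
    have -> : ((d + d).+2 * q ^ k = d.+1 * q ^ k + d.+1 * q ^ k)%N by ring.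
    lia.
  rewrite divn_small //; apply: leq_trans (_ : q ^ t.+1 <= _)%N; last by rewrite leq_exp2l.
  exact: trunc_log_ltn.
rewrite big_split /= -vE [in X in (X <= _)%N]addnC leq_add2l => /leq_trans; apply.
rewrite (big_cat_nat _ _ (n := t.+1)) //=.
rewrite [X in (_ + X)%N]big1_seq ?addn0; last first.
  by move=> k /andP[_]; rewrite mem_index_iota => /andP[tk _]; rewrite leqNgt tk.
apply: (@leq_trans (\sum_(1 <= k < t.+1) 1)).
  by apply: leq_sum => k _; exact: leq_b1.
by rewrite sum_nat_const_nat subn1 muln1.
Qed.

Lemma sqr_le_expn2 k : (k ^ 2 <= 2 ^ k.+1)%N.
Proof.
case: k => [|[|[|k]]] //; elim: k => // k IH.
by move: IH; rewrite (expnS 2 k.+4) -!mulnn; move: (2 ^ k.+4)%N => X; nia.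
Qed.

(** Each prime power that divides 'C(2 n, n) exactly is at most 2 n, whence
    2^n <= 'C(2 n, n) <= (2 n)^r, r being the number of primes up to 2 n. So
    n <= k r with 2^k about 2 n, and k^2 = O(n). *)
Lemma chebyshev_weak n : (n <= 8 * size (primes_upto (2 * n)) ^ 2)%N.
Proof.
have [->|n0] := posnP n; first by [].
set r := size _; pose k := up_log 2 (2 * n).
have C0 : (0 < 'C(2 * n, n))%N by rewrite bin_gt0; lia.
have n_kr : (n <= k * r)%N.
  rewrite -(@leq_exp2l 2) //; apply: leq_trans (expn2_le_central_bin n) _.
  rewrite {1}(prod_prime_decomp C0) prime_decompE big_map /=.
  apply: (@leq_trans (\prod_(q <- primes 'C(2 * n, n)) (2 * n))).
    rewrite !big_seq; apply: leq_prod => q; rewrite mem_primes => /and3P[pq _ _].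
    exact: central_bin_pfactor.
  rewrite big_const_seq count_predT iter_muln_1 expnM.
  apply: (@leq_trans ((2 * n) ^ r)).
    rewrite leq_pexp2l //; first by lia.
    apply: uniq_leq_size; first exact: primes_uniq.
    move=> q; rewrite mem_primes => /and3P[pq _ qC].
    rewrite mem_filter pq mem_iota prime_gt0 //= add1n ltnS.
    apply: leq_trans (central_bin_pfactor pq n0).
    by rewrite -{1}[q]expn1 leq_exp2l ?prime_gt1 // logn_gt0 mem_primes pq C0.
  have [r0|r0] := posnP r; first by rewrite r0.
  rewrite leq_exp2r //; exact: up_logP.
have k2 : (k ^ 2 <= 8 * n)%N.
  have := sqr_le_expn2 k.
  have /andP[] := @up_log_bounds 2 (2 * n) isT (ltac:(lia)); rewrite -/k.
  case: (k) => [|k'] /=; first by lia.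
  by rewrite !expnS; lia.
rewrite -(leq_pmul2l n0) mulnn.
apply: leq_trans (_ : (k * r) ^ 2 <= _)%N; first by rewrite leq_exp2r.
by rewrite expnMn; nia.
Qed.

Section TuringMachines.
Local Open Scope nat_scope.

(** * A while language and its compilation to Turing machines *)

(** Programs on counters that hold natural numbers, with a one-way input word
    and a write-only output word. *)
Inductive cmd :=
  | Skip
  | Inc of nat | Dec of nat | Out of bool
  | Seq of cmd & cmd
  | While of nat & cmd
  | IfZ of nat & cmd & cmd
  | ForInput of cmd & cmd.

(** The remaining input, the counters and the output written so far. *)
Definition store : Type := (seq bool * seq nat * seq bool)%type.
Notation "s `_[ i ]" := (nth 0 s i) (at level 3, format "s `_[ i ]").

(** The third argument is the exact number of steps that the compiled code
    takes, jumps included. *)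
Inductive exec : cmd -> store -> nat -> store -> Prop :=
  | ExecSkip x : exec Skip x 0 x
  | ExecInc i w s v : exec (Inc i) (w, s, v) 1 (w, set_nth 0 s i s`_[i].+1, v)
  | ExecDec i w s v : exec (Dec i) (w, s, v) 1 (w, set_nth 0 s i s`_[i].-1, v)
  | ExecOut b w s v : exec (Out b) (w, s, v) 1 (w, s, rcons v b)
  | ExecSeq c1 c2 x y z t1 t2 : exec c1 x t1 y -> exec c2 y t2 z ->
      exec (Seq c1 c2) x (t1 + t2) z
  | ExecWhileDone i c w s v : s`_[i] = 0 -> exec (While i c) (w, s, v) 1 (w, s, v)
  | ExecWhile i c w s v y z t1 t2 : s`_[i] != 0 -> exec c (w, s, v) t1 y ->
      exec (While i c) y t2 z -> exec (While i c) (w, s, v) (t1 + t2).+2 z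
  (* the code of c2 comes first and ends with a jump over that of c1 *)
  | ExecIf i c1 c2 w s v y t : exec (if s`_[i] == 0 then c1 else c2) (w, s, v) t y ->
      exec (IfZ i c1 c2) (w, s, v) (if s`_[i] == 0 then t.+1 else t.+2) y
  | ExecInputDone c0 c1 s v : exec (ForInput c0 c1) ([::], s, v) 1 ([::], s, v)
  | ExecInput c0 c1 b w s v y z t1 t2 : exec (if b then c1 else c0) (w, s, v) t1 y ->
      exec (ForInput c0 c1) y t2 z ->
      exec (ForInput c0 c1) (b :: w, s, v) (t1 + t2).+2 z.

Lemma exec_size_output c x t y : exec c x t y -> size y.2 <= size x.2 + t.
Proof.
elim=> //=; try by move=> *; rewrite ?size_rcons; lia.
all: try (by move=> *; try case: ifP; lia).
Qed.

Fixpoint counters_below k c : bool :=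
  match c with
  | Inc i | Dec i => i < k
  | Skip | Out _ => true
  | Seq c1 c2 | ForInput c1 c2 => counters_below k c1 && counters_below k c2
  | While i c => (i < k) && counters_below k c
  | IfZ i c1 c2 => [&& i < k, counters_below k c1 & counters_below k c2]
  end.

(** The first and the last two instructions frame the code of a program: see
    [machine_of]. *)
Inductive instr :=
  | IInit | IInc of nat | IDec of nat | IOut of bool
  | IJumpZ of nat & nat | IJump of nat | IRead of nat & nat
  | IBack | IRewind.

Fixpoint code_size c : nat :=
  match c with
  | Skip => 0
  | Inc _ | Dec _ | Out _ => 1
  | Seq c1 c2 => code_size c1 + code_size c2
  | While _ c => (code_size c).+2
  | IfZ _ c1 c2 => (code_size c1 + code_size c2).+2
  | ForInput c0 c1 => (code_size c0 + code_size c1).+3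
  end.

Fixpoint compile a c : seq instr :=
  match c with
  | Skip => [::]
  | Inc i => [:: IInc i]
  | Dec i => [:: IDec i]
  | Out b => [:: IOut b]
  | Seq c1 c2 => compile a c1 ++ compile (a + code_size c1) c2
  | While i c => IJumpZ i (a + (code_size c).+2) :: compile a.+1 c ++ [:: IJump a]
  | IfZ i c1 c2 => IJumpZ i (a + (code_size c2).+2) :: compile a.+1 c2 ++
      IJump (a + (code_size c1 + code_size c2).+2) :: compile (a + (code_size c2).+2) c1
  | ForInput c0 c1 => IRead (a + (code_size c1).+2) (a + (code_size c0 + code_size c1).+3) ::
      compile a.+1 c1 ++ IJump a :: compile (a + (code_size c1).+2) c0 ++ [:: IJump a]
  end.

Lemma size_compile a c : size (compile a c) = code_size c.
Proof.
elim: c a => //= [c1 IH1 c2 IH2 a|i c IH a|i c1 IH1 c2 IH2 a|c0 IH0 c1 IH1 a];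
  rewrite ?size_cat /= ?size_cat /= ?IH ?IH1 ?IH2 ?IH0; lia.
Qed.

Section Machine.
Variable k : nat.
Variable prog : seq instr.
Local Notation tapes := 'I_k.+2.
Definition counter_tape i : tapes := inord i.+1.

Definition at_tape (j : tapes) (a : option bool * move) (rd : tapes -> option bool) : 
  tapes -> option bool * move := fun i => if i == j then a else (rd i, Stay).
Definition idle (rd : tapes -> option bool) i : option bool * move := (rd i, Stay).

Definition instr_action (ins : instr) (pc : nat) (rd : tapes -> option bool) :
    nat * (tapes -> option bool * move) :=
  match ins with
  | IInit => (pc.+1, fun i => if (i == ord0) || (i == ord_max) then (rd i, Stay) else (Some true, Stay))
  | IInc i => (pc.+1, at_tape (counter_tape i) (rd (counter_tape i), MoveRight) rd)
  | IDec i => (pc.+1, if rd (counter_tape i) is Some _ then idle rd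
      else at_tape (counter_tape i) (None, MoveLeft) rd)
  | IOut b => (pc.+1, at_tape ord_max (Some b, MoveRight) rd)
  | IJumpZ i a => (if rd (counter_tape i) is Some _ then a else pc.+1, idle rd)
  | IJump a => (a, idle rd)
  | IRead a0 a => match rd ord0 with
      | None => (a, idle rd)
      | Some b => (if b then pc.+1 else a0, at_tape ord0 (Some b, MoveRight) rd)
      end
  | IBack => (pc.+1, at_tape ord_max (rd ord_max, MoveLeft) rd)
  | IRewind => if rd ord_max is Some _ then (pc, at_tape ord_max (rd ord_max, MoveLeft) rd)
      else (pc.+1, at_tape ord_max (None, MoveRight) rd)
  end.

(** The control states are the positions in the code. Tape 0 carries the input,
    the last tape the output, and the tapes between them the counters. *)
Definition code_machine : machine :=
  @Machine k.+1 'I_(size prog).+1 ord0 (fun q => q == ord_max)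
    (fun q rd => let a := instr_action (nth IInit prog q) q rd in
       (inord a.1, [ffun i => a.2 i])).

Definition blank (s : seq (option bool)) := all (pred1 None) s.

(** Every action pads its tape with a blank when the head is beyond the cells
    visited so far, hence tapes are described up to trailing blanks. *)
Definition is_input w (t : tape) := exists2 r, blank r & t.2 = map Some w ++ r.
(** A counter is the distance of the head from a mark; all other cells stay
    blank. So counting is moving the head, and testing for zero is reading. *)
Definition is_counter n (t : tape) :=
  if n is m.+1 then t.1 = rcons (nseq m None) (Some true) /\ blank t.2
  else [/\ t.1 = [::], head None t.2 = Some true & blank (behead t.2)].
Definition is_output v (t : tape) := t.1 = rev (map Some v) /\ blank t.2.

Lemma blank_head s : blank s -> head None s = None.
Proof. by case: s => //= x s /andP[/eqP]. Qed.
Lemma blank_behead s : blank s -> blank (behead s).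
Proof. by case: s => //= x s /andP[]. Qed.

Definition stay (t : tape) := tape_act t (tape_read t, Stay).

Lemma stay_input w t : is_input w t -> is_input w (stay t).
Proof.
case: t => l r [r' br /= ->]; case: w => [|b w] /=; last by exists r'.
exists (None :: behead r') => //=; first exact: blank_behead.
by rewrite /tape_read /= blank_head.
Qed.
Lemma stay_counter n t : is_counter n t -> is_counter n (stay t).
Proof.
case: t => l r; rewrite /stay /tape_read; case: n => [|n] /= [].
  by move=> -> -> br.
by move=> -> br; split=> //=; rewrite (blank_head br) /= blank_behead.
Qed.
Lemma stay_output v t : is_output v t -> is_output v (stay t).
Proof.
case: t => l r [/= -> br]; split=> //=.
by rewrite /tape_read /= (blank_head br) /= blank_behead.
Qed.

Definition represents (C : config code_machine) pc (x : store) :=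
  [/\ C.1 = pc :> nat, is_input x.1.1 (C.2 ord0),
      forall i, i < k -> is_counter x.1.2`_[i] (C.2 (counter_tape i))
    & is_output x.2 (C.2 ord_max)].

Lemma rep_pc C pc x : represents C pc x -> C.1 = pc :> nat.
Proof. by case. Qed.

Lemma counter_tape0 i : i < k -> (counter_tape i == ord0) = false.
Proof. by move=> ik; apply/eqP => /(congr1 val); rewrite /= inordK // !ltnS ltnW. Qed.
Lemma counter_tape_max i : i < k -> (counter_tape i == ord_max) = false.
Proof. by move=> ik; apply/eqP => /(congr1 val) /=; rewrite inordK ?ltnS //; lia. Qed.
Lemma counter_tape_eq i j : i < k -> j < k -> (counter_tape i == counter_tape j) = (i == j).
Proof. by move=> ik jk; rewrite -val_eqE /= !inordK ?eqSS //; lia. Qed.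
Lemma max_tape0 : (ord_max == ord0 :> tapes) = false.
Proof. by rewrite -val_eqE. Qed.

Lemma step_code (C : config code_machine) pc ins : C.1 = pc :> nat -> pc < size prog -> nth IInit prog pc = ins ->
  step C = (inord (instr_action ins pc (fun i => tape_read (C.2 i))).1,
    [ffun i => tape_act (C.2 i) ((instr_action ins pc (fun i => tape_read (C.2 i))).2 i)]).
Proof.
move=> Cpc pcs nE; rewrite /step /= -val_eqE /= Cpc ltn_eqF //= nE.
have -> : [ffun i => tape_read (C.2 i)] = (fun i => tape_read (C.2 i)) :> (tapes -> option bool).
  by apply/funext => i; rewrite ffunE.
by congr (_, _); apply/ffunP => i; rewrite !ffunE.
Qed.

Definition reaches pc x t pc' x' := forall C, represents C pc x ->
  represents (iter t (@step code_machine) C) pc' x'.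

Lemma reaches_trans pc1 x1 t1 pc2 x2 t2 pc3 x3 :
  reaches pc1 x1 t1 pc2 x2 -> reaches pc2 x2 t2 pc3 x3 -> reaches pc1 x1 (t1 + t2) pc3 x3.
Proof. by move=> h1 h2 C /h1/h2; rewrite addnC iterD. Qed.

Lemma reaches_idle pc x ins pc' : nth IInit prog pc = ins -> pc < size prog -> pc' <= size prog ->
  (forall C, represents C pc x ->
     instr_action ins pc (fun i => tape_read (C.2 i)) = (pc', idle (fun i => tape_read (C.2 i)))) ->
  reaches pc x 1 pc' x.
Proof.
move=> nE pcs pc's h C rC; rewrite /= (step_code (rep_pc rC) pcs nE) (h _ rC) /=.
case: rC => _ iC cC oC; split; rewrite /= ?inordK ?ltnS ?ffunE //.
- exact: stay_input.
- by move=> i ik; rewrite ffunE; apply/stay_counter/cC.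
- exact: stay_output.
Qed.

Lemma read_counter (C : config code_machine) pc x i : i < k -> represents C pc x ->
  tape_read (C.2 (counter_tape i)) = if x.1.2`_[i] == 0 then Some true else None.
Proof.
move=> ik [_ _ /(_ i ik)]; case: (x.1.2`_[i]) => [[_ hd _]|m [_ br]] _ //=.
exact: blank_head.
Qed.

Lemma read_input (C : config code_machine) pc x : represents C pc x ->
  tape_read (C.2 ord0) = ohead x.1.1.
Proof.
case=> _ [r br E] _ _; rewrite /tape_read E; case: (x.1.1) => //=.
exact: blank_head.
Qed.

Lemma reaches_inc pc i w s v : nth IInit prog pc = IInc i -> pc < size prog -> i < k ->
  reaches pc (w, s, v) 1 pc.+1 (w, set_nth 0 s i s`_[i].+1, v).
Proof.
move=> nE pcs ik C rC; rewrite /= (step_code (rep_pc rC) pcs nE) /=.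
case: rC => _ iC cC oC; split; rewrite /= ?inordK ?ltnS ?ffunE //.
- by rewrite /at_tape eq_sym counter_tape0 //; exact: stay_input.
- move=> j jk; rewrite ffunE /at_tape counter_tape_eq // nth_set_nth /=.
  have [->|_] := eqVneq j i; last exact/stay_counter/cC.
  have := cC i ik; case: (C.2 _) => l r /=; rewrite /tape_read /tape_act /=.
  case: (s`_[i]) => [|m] /= []; first by move=> -> -> br.
  by move=> -> br; rewrite (blank_head br) blank_behead.
- by rewrite /at_tape eq_sym counter_tape_max //; exact: stay_output.
Qed.

Lemma reaches_dec pc i w s v : nth IInit prog pc = IDec i -> pc < size prog -> i < k ->
  reaches pc (w, s, v) 1 pc.+1 (w, set_nth 0 s i s`_[i].-1, v).
Proof.
move=> nE pcs ik C rC; rewrite /= (step_code (rep_pc rC) pcs nE) /= (read_counter ik rC).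
case: rC => _ iC cC oC; split; rewrite /= ?inordK ?ltnS ?ffunE //.
- case: ifP => _ /=; first exact: stay_input.
  by rewrite /at_tape eq_sym counter_tape0 //; exact: stay_input.
- move=> j jk; rewrite ffunE nth_set_nth /=.
  have ci := cC i ik; have cj := stay_counter (cC j jk).
  case: (eqVneq s`_[i] 0) => [si|si] /=.
    by have [ji|//] := eqVneq j i; move: cj; rewrite ji si.
  rewrite /at_tape counter_tape_eq //; have [->|//] := eqVneq j i.
  move: ci si; case: (C.2 _) => l r /=; rewrite /tape_read /tape_act /=.
  by case: (s`_[i]) => [//|[|m]] /= [-> br] _; rewrite blank_behead.
- case: ifP => _ /=; first exact: stay_output.
  by rewrite /at_tape eq_sym counter_tape_max //; exact: stay_output.
Qed.

Lemma reaches_out pc b w s v : nth IInit prog pc = IOut b -> pc < size prog ->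
  reaches pc (w, s, v) 1 pc.+1 (w, s, rcons v b).
Proof.
move=> nE pcs C rC; rewrite /= (step_code (rep_pc rC) pcs nE) /=.
case: rC => _ iC cC oC; split; rewrite /= ?inordK ?ltnS ?ffunE //.
- by rewrite /at_tape eq_sym max_tape0; exact: stay_input.
- by move=> j jk; rewrite ffunE /at_tape counter_tape_max //; exact/stay_counter/cC.
- rewrite /at_tape eqxx; case: oC; case: (C.2 _) => l r /= -> br.
  rewrite /is_output /tape_act /= map_rcons rev_rcons; by split=> //; exact: blank_behead.
Qed.

Lemma reaches_read pc a0 a b w s v : nth IInit prog pc = IRead a0 a -> pc < size prog ->
  a0 <= size prog ->
  reaches pc (b :: w, s, v) 1 (if b then pc.+1 else a0) (w, s, v).
Proof.
move=> nE pcs a0s C rC; rewrite /= (step_code (rep_pc rC) pcs nE) /= (read_input rC) /=.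
case: rC => _ [r br E] cC oC; split; rewrite /= ?inordK ?ltnS ?ffunE //.
- by case: (b).
- exists r => //; rewrite /at_tape eqxx; move: E; case: (C.2 _) => l r' /= -> /=.
  by case: (w) => [|b' w'] //=; case: (r) br => //= ? ? /andP[/eqP ->].
- by move=> j jk; rewrite ffunE /at_tape counter_tape0 //; exact/stay_counter/cC.
- by rewrite /at_tape max_tape0; exact: stay_output.
Qed.


Definition segment pc s :=
  pc + size s <= size prog /\ forall i, i < size s -> nth IInit prog (pc + i) = nth IInit s i.

Lemma segment_cat pc s1 s2 : segment pc (s1 ++ s2) ->
  segment pc s1 /\ segment (pc + size s1) s2.
Proof.
rewrite /segment size_cat addnA => -[le nE].
split; (split; [|move=> i si]) => //.
- by apply: leq_trans le; rewrite leq_addr.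
- by rewrite nE ?nth_cat ?si // ltn_addr.
- by rewrite -addnA nE ?ltn_add2l // nth_cat ltnNge leq_addr /= addKn.
Qed.

Lemma segment_cons pc ins s : segment pc (ins :: s) ->
  [/\ nth IInit prog pc = ins, pc < size prog & segment pc.+1 s].
Proof.
rewrite -cat1s => /segment_cat[[/= le nE] sg]; rewrite addn1 in le sg; split=> //.
by have := nE 0 isT; rewrite addn0.
Qed.

Lemma reaches_jump pc x a : nth IInit prog pc = IJump a -> pc < size prog -> a <= size prog ->
  reaches pc x 1 a x.
Proof. by move=> nE pcs as_; apply: (reaches_idle nE pcs as_) => C _. Qed.

Lemma reaches_jumpz pc i a w s v : nth IInit prog pc = IJumpZ i a -> pc < size prog ->
  a <= size prog -> i < k ->
  reaches pc (w, s, v) 1 (if s`_[i] == 0 then a else pc.+1) (w, s, v).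
Proof.
move=> nE pcs as_ ik; apply: (reaches_idle nE pcs) => [|C rC]; first by case: ifP.
by rewrite /= (read_counter ik rC) /=; case: ifP.
Qed.

Lemma reaches_read_end pc a0 a s v : nth IInit prog pc = IRead a0 a -> pc < size prog ->
  a <= size prog -> reaches pc ([::], s, v) 1 a ([::], s, v).
Proof.
move=> nE pcs as_; apply: (reaches_idle nE pcs as_) => C rC.
by rewrite /= (read_input rC).
Qed.

Lemma reaches_exec c x t y : exec c x t y -> counters_below k c ->
  forall a, segment a (compile a c) -> reaches a x t (a + code_size c) y.
Proof.
elim=> {c x t y} [x|i w s v|i w s v|b w s v|c1 c2 x y z t1 t2 _ IH1 _ IH2
  |i c w s v s0|i c w s v y z t1 t2 s0 _ IH1 _ IH2|i c1 c2 w s v y t _ IH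
  |c0 c1 s v|c0 c1 b w s v y z t1 t2 _ IH1 _ IH2] /=.
- by move=> _ a _; rewrite addn0.
- by move=> ik a /segment_cons[nE le _]; rewrite addn1; exact: reaches_inc.
- by move=> ik a /segment_cons[nE le _]; rewrite addn1; exact: reaches_dec.
- by move=> _ a /segment_cons[nE le _]; rewrite addn1; exact: reaches_out.
- move=> /andP[k1 k2] a /segment_cat[sg1]; rewrite size_compile => sg2.
  rewrite addnA; exact: reaches_trans (IH1 k1 _ sg1) (IH2 k2 _ sg2).
- move=> /andP[ik kc] a sg; have [nE le _] := segment_cons sg; case: (sg) => sz _.
  have := reaches_jumpz (w := w) (s := s) (v := v) nE le _ ik; rewrite s0; apply.
  by move: sz; rewrite /= size_cat size_compile /=; lia.
- move=> /andP[ik kc] a sg; case: (sg) => sz _; rewrite /= size_cat size_compile /= in sz.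
  have [nE le /segment_cat[sgc]] := segment_cons sg.
  rewrite size_compile addSn => /segment_cons[nJ leJ _].
  have -> : (t1 + t2).+2 = 1 + (t1 + (1 + t2)) by lia.
  have := reaches_jumpz (w := w) (s := s) (v := v) nE le (ltac:(lia)) ik; rewrite (negbTE s0) => st.
  apply: (reaches_trans st); apply: (reaches_trans (IH1 kc _ sgc)); rewrite (addSn a).
  apply: (reaches_trans (reaches_jump nJ leJ (ltnW le))).
  by apply: IH2 => //=; rewrite ik.
- move=> /and3P[ik k1 k2] a sg; case: (sg) => sz _; rewrite /= size_cat /= !size_compile in sz.
  have [nE le /segment_cat[sg2]] := segment_cons sg.
  rewrite size_compile addSn => /segment_cons[nJ leJ].
  have -> : (a + code_size c2).+2 = a + (code_size c2).+2 by lia.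
  move=> sg1; have := reaches_jumpz (w := w) (s := s) (v := v) nE le (ltac:(lia)) ik.
  case: (s`_[i] == 0) IH => IH st.
    have -> : a + (code_size c1 + code_size c2).+2 = a + (code_size c2).+2 + code_size c1 by lia.
    by rewrite -add1n; apply: (reaches_trans st); exact: IH.
  have -> : t.+2 = 1 + (t + 1) by lia.
  apply: (reaches_trans st); apply: (reaches_trans (IH k2 _ sg2)); rewrite (addSn a).
  by apply: (reaches_jump nJ leJ); lia.
- move=> _ a sg; case: (sg) => sz _; rewrite /= !size_cat /= !size_cat !size_compile /= in sz.
  have [nE le _] := segment_cons sg.
  by apply: (reaches_read_end nE le); lia.
- move=> /andP[k0 k1] a sg; case: (sg) => sz _; rewrite /= !size_cat /= !size_cat !size_compile /= in sz.
  have [nE le /segment_cat[sg1]] := segment_cons sg.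
  rewrite size_compile addSn => /segment_cons[nJ1 leJ1].
  have -> : (a + code_size c1).+2 = a + (code_size c1).+2 by lia.
  move=> /segment_cat[sg0]; rewrite size_compile => /segment_cons[nJ0 leJ0 _].
  have -> : (t1 + t2).+2 = 1 + (t1 + (1 + t2)) by lia.
  apply: (reaches_trans (reaches_read (b := b) (w := w) (s := s) (v := v) nE le (ltac:(lia)))).
  case: b IH1 => IH1.
    apply: (reaches_trans (IH1 k1 _ sg1)); rewrite (addSn a).
    apply: (reaches_trans (reaches_jump nJ1 leJ1 (ltnW le))).
    by apply: IH2 => //=; rewrite k0.
  apply: (reaches_trans (IH1 k0 _ sg0)).
  apply: (reaches_trans (reaches_jump nJ0 leJ0 (ltnW le))).
  by apply: IH2 => //=; rewrite k0.
Qed.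

Lemma represents_init w : nth IInit prog 0 = IInit -> 0 < size prog ->
  represents (step (initial code_machine w)) 1 (w, [::], [::]).
Proof.
move=> nE ps; rewrite /step /= -val_eqE /= ltn_eqF // nE /=.
have max0 : (ord_max == ord0 :> tapes) = false by rewrite -val_eqE.
split; rewrite /= ?inordK ?ltnS ?ffunE //=.
- by apply: stay_input; exists [::]; rewrite ?cats0.
- by move=> i ik; rewrite !ffunE counter_tape0 // counter_tape_max //= nth_nil.
- by rewrite eqxx; apply: stay_output.
Qed.

(** The head is on the first letter of u (on a blank if u is empty), the other
    letters of u follow to the left, and v2 is to its right. *)
Definition rewinding u v2 (t : tape) :=
  t.1 = behead (map Some u) /\ exists2 r, blank r & t.2 = head None (map Some u) :: map Some v2 ++ r.

Lemma rewind_step q u v2 (C : config code_machine) : nth IInit prog q = IRewind -> q < size prog ->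
  C.1 = q :> nat -> rewinding u v2 (C.2 ord_max) ->
  let C' := iter (size u).+1 (@step code_machine) C in
  C'.1 = q.+1 :> nat /\ word_of (C'.2 ord_max).2 = rev u ++ v2.
Proof.
move=> nE qs; elim: u v2 C => [|x u IH] v2 C Cq [hl [r br hr]]; last first.
  rewrite iterSr (step_code Cq qs nE) /= /tape_read hr /= rev_cons cat_rcons; apply: IH.
    by rewrite inordK // ltnS ltnW.
  rewrite ffunE /at_tape eqxx /tape_act /= hl hr /=; split=> //; by exists r.
rewrite /= (step_code Cq qs nE) /= /tape_read hr /= ffunE /at_tape eqxx.
rewrite inordK // /tape_act /= hr /=; split=> //.
have wb : word_of r = [::] by case: (r) br => //= ? ? /andP[/eqP ->].
by case: v2 {hr} => [|y v2] /=; [case: (r) br wb => //= ? ? /andP[/eqP ->]|congr cons; elim: v2 => //= ? ? ->].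
Qed.

End Machine.

(** [IInit] marks the origins of the counters. As the output word is read off
    from the position of the head, the head of the output tape has to be moved
    back at the end: [IBack] leaves the blank behind the word, and [IRewind] runs
    to the blank before it. *)
Definition machine_of k c := code_machine k (IInit :: compile 1 c ++ [:: IBack; IRewind]).

Theorem machine_of_correct k c w t y : counters_below k c ->
  exec c (w, [::], [::]) t y ->
  computes_within (machine_of k c) (t + size y.2).+3 w y.2.
Proof.
move=> kc cy; pose prog := IInit :: compile 1 c ++ [:: IBack; IRewind].
rewrite /computes_within -[machine_of k c]/(code_machine k prog).
have sz : size prog = (code_size c).+3 by rewrite /= size_cat size_compile addn2.
have sg : segment prog 1 (compile 1 c ++ [:: IBack; IRewind]) by split=> [|i _]; rewrite ?add1n.
have [sgc /segment_cons[nB ltB /segment_cons[nR ltR _]]] := segment_cat sg.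
rewrite size_compile add1n in nB ltB nR ltR.
have r1 := @represents_init k prog w erefl isT.
have r2 := reaches_exec cy kc sgc r1; rewrite add1n in r2.
set C2 := iter t _ _ in r2.
have -> : (t + size y.2).+3 = (size (rev y.2)).+1 + (1 + (t + 1)) by rewrite size_rev; lia.
rewrite iterD (iterD 1) (iterD t) -[iter t _ _]/C2.
have [||C1 ->] := rewind_step (u := rev y.2) (v2 := [::]) nR ltR (C := step C2); last first.
- by rewrite revK cats0; split=> //; apply/eqP/val_inj; apply: (etrans C1); rewrite sz.
- case: r2 => pc2 _ _ []; rewrite (step_code pc2 ltB nB) /= ffunE /at_tape eqxx.
  case: (C2.2 _) => l r /= -> br; rewrite /rewinding /tape_act /tape_read /= map_rev; split=> //.
  by exists (None :: behead r) => //=; [exact: blank_behead | rewrite (blank_head br)].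
by rewrite (step_code (rep_pc r2) ltB nB) /= inordK // ltnS ltnW.
Qed.

(** * Reasoning about programs *)

Definition runs c x B y := exists2 t, t <= B & exec c x t y.

Lemma runs_le c x B B' y : runs c x B y -> B <= B' -> runs c x B' y.
Proof. by case=> t tB e BB'; exists t => //; exact: leq_trans BB'. Qed.

Lemma runs_skip x : runs Skip x 0 x.
Proof. by exists 0 => //; constructor. Qed.
Lemma runs_inc i w s v : runs (Inc i) (w, s, v) 1 (w, set_nth 0 s i s`_[i].+1, v).
Proof. by exists 1 => //; constructor. Qed.
Lemma runs_dec i w s v : runs (Dec i) (w, s, v) 1 (w, set_nth 0 s i s`_[i].-1, v).
Proof. by exists 1 => //; constructor. Qed.
Lemma runs_out b w s v : runs (Out b) (w, s, v) 1 (w, s, rcons v b).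
Proof. by exists 1 => //; constructor. Qed.
Lemma runs_seq c1 c2 x y z B1 B2 : runs c1 x B1 y -> runs c2 y B2 z ->
  runs (Seq c1 c2) x (B1 + B2) z.
Proof.
case=> t1 l1 e1 [t2 l2 e2]; exists (t1 + t2); first exact: leq_add.
exact: ExecSeq e1 e2.
Qed.
Lemma runs_if i c1 c2 w s v y B : runs (if s`_[i] == 0 then c1 else c2) (w, s, v) B y ->
  runs (IfZ i c1 c2) (w, s, v) B.+2 y.
Proof.
case=> t l e; exists (if s`_[i] == 0 then t.+1 else t.+2); last exact: ExecIf.
by case: ifP => _; lia.
Qed.

(** The invariant S m describes the store after m rounds. *)
Lemma runs_while i c (S : nat -> store) B n :
  (forall m, m < n -> (S m).1.2`_[i] != 0 /\ runs c (S m) B (S m.+1)) ->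
  (S n).1.2`_[i] = 0 -> runs (While i c) (S 0) (n * B.+2 + 1) (S n).
Proof.
elim: n S => [|n IH] S h S0.
  by exists 1 => //; case: (S 0) S0 => [[w s] v] s0; exact: ExecWhileDone.
have [Sn [t tB e]] := h 0 isT.
have [t' t'B e'] := IH (fun m => S m.+1) (fun m mn => h m.+1 mn) S0.
exists (t + t').+2; first by rewrite mulSn; lia.
by case: (S 0) Sn e => [[w s] v] /= s0 e; exact: ExecWhile s0 e e'.
Qed.

Definition Clear i := While i (Dec i).
Definition Move i k := While i (Seq (Dec i) (Inc k)).
Definition Move2 i k l := While i (Seq (Dec i) (Seq (Inc k) (Inc l))).

Lemma set_nth_id (s : seq nat) i : i < size s -> set_nth 0 s i s`_[i] = s.
Proof.
move=> si; apply: (@eq_from_nth _ 0) => [|j _]; first by rewrite size_set_nth (maxn_idPr si).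
by rewrite nth_set_nth /=; case: eqP => // ->.
Qed.

Lemma runs_clear i w s v : i < size s ->
  runs (Clear i) (w, s, v) (s`_[i] * 3 + 1) (w, set_nth 0 s i 0, v).
Proof.
move=> si; pose S m : store := (w, set_nth 0 s i (s`_[i] - m), v).
have S0 : S 0 = (w, s, v) by rewrite /S subn0 set_nth_id.
have Sn : S s`_[i] = (w, set_nth 0 s i 0, v) by rewrite /S subnn.
rewrite -S0 -Sn; apply: runs_while => [m mi|]; last by rewrite Sn /= nth_set_nth /= eqxx.
rewrite /S /= nth_set_nth /= eqxx; split; first by lia.
have := runs_dec i w (set_nth 0 s i (s`_[i] - m)) v; congr runs.
by rewrite nth_set_nth /= eqxx set_set_nth eqxx; do 3!f_equal; lia.
Qed.

Lemma runs_move i k w s v : i < size s -> k < size s -> i != k ->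
  runs (Move i k) (w, s, v) (s`_[i] * 4 + 1)
    (w, set_nth 0 (set_nth 0 s k (s`_[k] + s`_[i])) i 0, v).
Proof.
move=> si sk ik; pose S m : store := (w, set_nth 0 (set_nth 0 s k (s`_[k] + m)) i (s`_[i] - m), v).
have S0 : S 0 = (w, s, v) by rewrite /S subn0 addn0 (set_nth_id sk) set_nth_id.
have Sn : S s`_[i] = (w, set_nth 0 (set_nth 0 s k (s`_[k] + s`_[i])) i 0, v) by rewrite /S subnn.
rewrite -S0 -Sn; apply: runs_while => [m mi|]; last by rewrite Sn /= nth_set_nth /= eqxx.
split; first by rewrite /S /= nth_set_nth /= eqxx; lia.
apply: (@runs_le _ _ (1 + 1)) => //; apply: runs_seq; first exact: runs_dec.
have E : set_nth 0 (set_nth 0 (set_nth 0 s k (s`_[k] + m)) i (s`_[i] - m)) i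
    (set_nth 0 (set_nth 0 s k (s`_[k] + m)) i (s`_[i] - m))`_[i].-1 =
    set_nth 0 (set_nth 0 s k (s`_[k] + m)) i (s`_[i] - m.+1).
  by rewrite nth_set_nth /= eqxx set_set_nth eqxx; f_equal; lia.
rewrite E; have := runs_inc k w (set_nth 0 (set_nth 0 s k (s`_[k] + m)) i (s`_[i] - m.+1)) v.
congr runs; rewrite /S; do 2!f_equal.
apply: (@eq_from_nth _ 0) => [|j _]; first by rewrite !size_set_nth; lia.
do ?rewrite nth_set_nth /=; rewrite !eqxx (eq_sym k i) (negbTE ik).
have [->|jk] := eqVneq j k; first by rewrite eq_sym (negbTE ik) addnS.
by do ?rewrite nth_set_nth /=; rewrite ?(negbTE jk).
Qed.

Lemma runs_move2 i k l w s v : i < size s -> k < size s -> l < size s ->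
  [&& i != k, i != l & k != l] ->
  runs (Move2 i k l) (w, s, v) (s`_[i] * 5 + 1)
    (w, set_nth 0 (set_nth 0 (set_nth 0 s k (s`_[k] + s`_[i])) l (s`_[l] + s`_[i])) i 0, v).
Proof.
move=> si sk sl /and3P[ik il kl].
pose s' m := set_nth 0 (set_nth 0 (set_nth 0 s k (s`_[k] + m)) l (s`_[l] + m)) i (s`_[i] - m).
pose S m : store := (w, s' m, v).
have S0 : S 0 = (w, s, v) by rewrite /S /s' subn0 !addn0 (set_nth_id sk) (set_nth_id sl) set_nth_id.
have Sn : S s`_[i] = (w, set_nth 0 (set_nth 0 (set_nth 0 s k (s`_[k] + s`_[i])) l (s`_[l] + s`_[i])) i 0, v).
  by rewrite /S /s' subnn.
rewrite -S0 -Sn; apply: runs_while => [m mi|]; last by rewrite Sn /= nth_set_nth /= eqxx.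
split; first by rewrite /S /= nth_set_nth /= eqxx; lia.
apply: (@runs_le _ _ (1 + (1 + 1))) => //; apply: runs_seq; first exact: runs_dec.
apply: runs_seq; first exact: runs_inc.
rewrite /S; set s1 := set_nth 0 (s' m) i _; set s2 := set_nth 0 s1 k _.
have -> : s' m.+1 = set_nth 0 s2 l s2`_[l].+1; last exact: runs_inc.
rewrite /s2 /s1 /s'.
apply: (@eq_from_nth _ 0) => [|j _]; first by rewrite !size_set_nth; lia.
do ?rewrite nth_set_nth /=; rewrite !eqxx.
rewrite !(eq_sym l) !(eq_sym k i) (negbTE ik) (negbTE il) (negbTE kl).
have [->|ji] := eqVneq j i; first by rewrite (negbTE ik) (negbTE il); lia.
by case: (j == l); case: (j == k); rewrite ?addnS.
Qed.

(** * The program *)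

(** The registers: j, then p - 2 and p for the current candidate p, two registers
    in which loops save the counters they consume, two for remainders and
    quotients, a flag or a count, the current a, and powers of a. The value
    p - 2 is the number of possible proper divisors d of p with d > 1, and
    also one less than the number of zero coefficients of X^p - a. *)
Notation rJ := 0. Notation rP1 := 1. Notation rP := 2.
Notation rT1 := 3. Notation rT2 := 4. Notation rY := 5. Notation rZ := 6.
Notation rF := 7. Notation rA := 8. Notation rX := 9.

Lemma runs_conv c x B B' y y' : runs c x B y -> y = y' -> B <= B' -> runs c x B' y'.
Proof. by move=> h <-; apply: runs_le. Qed.

Ltac rprim := first [ exact: runs_inc | exact: runs_dec | exact: runs_out | exact: runs_skip
  | exact: runs_move | exact: runs_move2 | exact: runs_clear ].
Ltac rseq := eapply runs_seq; [ rprim | rewrite /= ].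

Ltac regs := rewrite /=; congr (_, [:: _; _; _; _; _; _; _; _; _; _], _); lia.
Ltac rblock := apply: runs_conv; [repeat rseq; rprim | regs | rewrite /=; lia].

(** The digits come least significant first: rA holds the weight of the next
    digit and is doubled in each round, rJ accumulates the value. *)
Definition read_bit0 := Seq (Move2 rA rT1 rT2) (Seq (Move rT1 rA) (Move rT2 rA)).
Definition read_bit1 := Seq (Move2 rA rT1 rT2) (Seq (Move2 rT1 rA rJ) (Move rT2 rA)).

Lemma runs_read_input w j a v :
  runs (ForInput read_bit0 read_bit1) (w, [:: j; 0; 0; 0; 0; 0; 0; 0; a; 0], v)
    (size w * (14 * (a * 2 ^ size w) + 5) + 1)
    ([::], [:: j + a * foldr (fun b n => nat_of_bool b + 2 * n) 0 w; 0; 0; 0; 0; 0; 0; 0; a * 2 ^ size w; 0], v).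
Proof.
elim: w j a => [|b w IH] j a /=.
  by exists 1 => //; rewrite muln0 addn0 muln1; constructor.
have [t1 l1 e1] : runs (if b then read_bit1 else read_bit0) (w, [:: j; 0; 0; 0; 0; 0; 0; 0; a; 0], v)
   (14 * a + 3) (w, [:: j + a * b; 0; 0; 0; 0; 0; 0; 0; 2 * a; 0], v).
  by case: b => /=; rblock.
have [t2 l2 e2] := IH (j + a * b) (2 * a).
exists (t1 + t2).+2.
  apply: (@leq_trans (14 * a + 3 + (size w * (14 * (2 * a * 2 ^ size w) + 5) + 1)).+2).
    by rewrite !ltnS leq_add.
  rewrite expnS mulnCA mulnA; move: (size w) (2 ^ size w) (expn_gt0 2 (size w)) => m X /= X0; nia.
have -> : j + a * (b + 2 * foldr (fun b n => nat_of_bool b + 2 * n) 0 w) =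
  j + a * b + 2 * a * foldr (fun b n => nat_of_bool b + 2 * n) 0 w by lia.
by rewrite expnS mulnCA mulnA; exact: ExecInput e1 e2.
Qed.

Lemma binary0 : binary 0 = [::].
Proof. by rewrite /binary up_log1. Qed.

Lemma binaryS n : 0 < n -> binary n = odd n :: binary n./2.
Proof.
move=> n0; rewrite /binary up_log2S // /mkseq /= divn1; congr (_ :: _).
rewrite -[1]/(1 + 0) iotaDl -map_comp; apply: eq_map => i /=.
by rewrite expnS divnMA divn2.
Qed.

Lemma binary_value n : foldr (fun b n => nat_of_bool b + 2 * n) 0 (binary n) = n.
Proof.
elim/ltn_ind: n => n IH; have [->|n0] := posnP n; first by rewrite binary0.
rewrite binaryS //= IH; last by rewrite ltn_half_double -addnn; lia.
by rewrite mul2n odd_double_half.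
Qed.

Lemma binary_size n : 2 ^ size (binary n) <= 2 * n + (n == 0).
Proof.
elim/ltn_ind: n => n IH; have [->|n0] := posnP n; first by rewrite binary0.
have nh := odd_double_half n; rewrite -muln2 in nh.
rewrite (binaryS n0) /= expnS; have := IH n./2 (ltac:(lia)).
by case: (n./2) nh => [|h] nh /=; lia.
Qed.

(** rY and rZ hold m mod d and d - m mod d. *)
Definition mod_step := Seq (Dec rZ) (Seq (Inc rY) (IfZ rZ (Move rY rZ) Skip)).

Lemma modn_succ m d : 0 < d -> m.+1 %% d = if (d - m %% d).-1 == 0 then 0 else (m %% d).+1.
Proof.
move=> d0; have md := ltn_pmod m d0; rewrite -[in LHS]addn1 -modnDml addn1.
case: eqP => h; first by rewrite (_ : (m %% d).+1 = d) ?modnn //; lia.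
by rewrite modn_small //; lia.
Qed.

Lemma runs_mod_step d m w v j p1 p t1 t2 f a x : 0 < d ->
  runs mod_step (w, [:: j; p1; p; t1; t2; m %% d; d - m %% d; f; a; x], v) (4 * d + 5)
    (w, [:: j; p1; p; t1; t2; m.+1 %% d; d - m.+1 %% d; f; a; x], v).
Proof.
move=> d0; have md := ltn_pmod m d0.
apply: (@runs_le _ _ (1 + (1 + (4 * d + 1).+2))); last by lia.
rseq; rseq; apply: runs_if => /=; rewrite (modn_succ m d0).
case: eqP => h.
  by apply: runs_conv; [rprim|regs|rewrite /=; lia].
by apply: runs_conv; [rprim|regs|rewrite /=; lia].
Qed.

Definition div_test :=
  Seq (While rP (Seq (Dec rP) (Seq (Inc rT2) mod_step)))
 (Seq (Move rT2 rP) (Seq (IfZ rY (Inc rF) Skip) (Seq (Move rY rZ) (Inc rZ)))).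

Lemma runs_div_test d w v j p1 p t1 f a x : 0 < d <= p ->
  runs div_test (w, [:: j; p1; p; t1; 0; 0; d; f; a; x], v) (p * (4 * p + 20) + 20)
    (w, [:: j; p1; p; t1; 0; 0; d.+1; f + (d %| p); a; x], v).
Proof.
move=> /andP[d0 dp]; have md := ltn_pmod p d0.
pose S m : store := (w, [:: j; p1; p - m; t1; m; m %% d; d - m %% d; f; a; x], v).
have loop : runs (While rP (Seq (Dec rP) (Seq (Inc rT2) mod_step))) (S 0)
    (p * (4 * p + 7).+2 + 1) (S p).
  apply: runs_while => [m mp|]; last by rewrite /S /= subnn.
  split; first by rewrite /S /=; lia.
  apply: (@runs_conv _ _ (1 + (1 + (4 * d + 5)))); [|reflexivity|by lia].
  rseq; rseq; have := runs_mod_step m w v j p1 (p - m.+1) t1 m.+1 f a x d0.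
  by congr runs; regs.
rewrite {1}/S subn0 mod0n subn0 /S subnn in loop.
apply: (@runs_le _ _ ((p * (4 * p + 7).+2 + 1) + ((4 * p + 1) + (3 + ((4 * p + 1) + 1))))); last by nia.
apply: runs_seq loop _.
apply: runs_seq; first by apply: runs_conv; [rprim|rewrite /=; reflexivity|rewrite /=; lia].
rewrite add0n; apply: (@runs_seq _ _ _ (w, [:: j; p1; p; t1; 0; p %% d; d - p %% d; f + (d %| p); a; x], v)).
  apply: runs_if => /=; rewrite /dvdn; case: (p %% d == 0).
    by apply: runs_conv; [rprim|regs|].
  by apply: runs_conv; [rprim|regs|].
apply: runs_seq; first by apply: runs_conv; [rprim|rewrite /=; reflexivity|rewrite /=; lia].
by apply: runs_conv; [rprim|regs|].
Qed.

Definition count_divisors :=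
  Seq (Inc rZ) (Seq (Inc rZ)
 (Seq (While rP1 (Seq (Dec rP1) (Seq (Inc rT1) div_test)))
 (Seq (Move rT1 rP1) (Clear rZ)))).

Definition ndivs n p := count (fun d => d %| p) (iota 2 n).

Lemma ndivs_prime n : (ndivs n n.+2 == 0) = prime n.+2.
Proof.
rewrite -leqn0 leqNgt -has_count; apply/idP/idP => [h|pp].
  rewrite -[prime _]negbK; apply: contra h => /primePn[//|[d /andP[d1 dn] dv]].
  by apply/hasP; exists d => //; rewrite mem_iota; lia.
apply/negP => /hasP[d]; rewrite mem_iota => dn dv.
by have /primeP[_ /(_ d dv) /pred2P[]] := pp; lia.
Qed.

Lemma runs_count_divisors n w v j a x :
  runs count_divisors (w, [:: j; n; n.+2; 0; 0; 0; 0; 0; a; x], v)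
    (n * (n.+2 * (4 * n.+2 + 20) + 40) + 20)
    (w, [:: j; n; n.+2; 0; 0; 0; 0; ndivs n n.+2; a; x], v).
Proof.
set B := n.+2 * (4 * n.+2 + 20) + 20.
pose S m : store := (w, [:: j; n - m; n.+2; m; 0; 0; m.+2; ndivs m n.+2; a; x], v).
have loop : runs (While rP1 (Seq (Dec rP1) (Seq (Inc rT1) div_test))) (S 0)
    (n * (1 + (1 + B)).+2 + 1) (S n).
  apply: runs_while => [m mn|]; last by rewrite /S /= subnn.
  split; first by rewrite /S /=; lia.
  rseq; rseq; have := @runs_div_test m.+2 w v j (n - m.+1) n.+2 m.+1 (ndivs m n.+2) a x (ltac:(lia)).
  congr runs; first by regs.
  by rewrite /S {2}/ndivs -[m.+1]addn1 iotaD count_cat /= addn0 addnC.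
apply: (@runs_le _ _ (1 + (1 + ((n * (1 + (1 + B)).+2 + 1) + ((4 * n + 1) + (3 * n.+2 + 1)))))); last by rewrite /B; nia.
rseq; rseq; apply: runs_seq; first by move: loop; rewrite {1}/S subn0; exact: id.
rewrite /S subnn; apply: runs_seq.
  by apply: runs_conv; [rprim|rewrite /=; reflexivity|rewrite /=; lia].
by apply: runs_conv; [rprim|regs|rewrite /=; lia].
Qed.

Definition odd_primes_below n := count prime (iota 3 n).

Lemma odd_primes_belowS n : odd_primes_below n.+1 = odd_primes_below n + prime n.+3.
Proof. by rewrite /odd_primes_below -[n.+1]addn1 iotaD count_cat /= addn0 addn1 add3n. Qed.

Lemma odd_primes_below_mono m n : m <= n -> odd_primes_below m <= odd_primes_below n.
Proof.
by move/subnKC <-; rewrite /odd_primes_below iotaD count_cat leq_addr.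
Qed.

Lemma odd_primes_unbounded j : exists n, j <= odd_primes_below n.
Proof.
elim: j => [|j [n IH]]; first by exists 0.
have [p np pp] := prime_above n.+2; exists (p - 2).
have pE : p - 2 = (p - 3).+1 by lia.
rewrite pE odd_primes_belowS (_ : (p - 3).+3 = p); last by lia.
by rewrite pp addn1 ltnS (leq_trans IH) // odd_primes_below_mono //; lia.
Qed.

(** The j-th prime, counted from j = 0, is [prime_index j + 2]; the shift is that of
    the register rP1. *)
Definition prime_index j := ex_minn (odd_primes_unbounded j).

Lemma prime_indexP j : odd_primes_below (prime_index j) = j /\
  forall m, m < prime_index j -> odd_primes_below m < j.
Proof.
rewrite /prime_index; case: ex_minnP => n jn min_n.
have lt m : m < n -> odd_primes_below m < j.
  by move=> mn; rewrite ltnNge; apply/negP => /min_n; lia.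
split=> //; apply/eqP; rewrite eqn_leq jn andbT.
case: n {jn min_n} lt => [|n] lt; first by rewrite /odd_primes_below.
by rewrite odd_primes_belowS; have := lt n (ltnSn n); case: prime; lia.
Qed.

Definition nth_prime j := (prime_index j).+2.

Lemma nth_prime_prime j : prime (nth_prime j).
Proof.
rewrite /nth_prime; have [nj lt] := prime_indexP j.
case: (prime_index j) nj lt => [|n] nj lt //.
move: nj; rewrite odd_primes_belowS; have := lt n (ltnSn n).
by case: prime => //; lia.
Qed.

Lemma nth_prime_lt j : nth_prime j < nth_prime j.+1.
Proof.
rewrite /nth_prime !ltnS ltnNge; apply/negP => /odd_primes_below_mono.
by rewrite (prime_indexP j).1 (prime_indexP j.+1).1 ltnn.
Qed.

Lemma leq_nth_prime j : j <= nth_prime j.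
Proof. by elim: j => // j IH; exact: leq_ltn_trans (nth_prime_lt j). Qed.

Definition find_prime := While rJ (Seq (Inc rP1) (Seq (Inc rP)
  (Seq count_divisors (IfZ rF (Dec rJ) (Clear rF))))).

Lemma runs_find_prime j v w :
  let n := prime_index j in
  runs find_prime (w, [:: j; 0; 2; 0; 0; 0; 0; 0; 0; 0], v)
    (n * (n * (n.+2 * (4 * n.+2 + 20) + 40) + 3 * n + 30) + 1)
    (w, [:: 0; n; n.+2; 0; 0; 0; 0; 0; 0; 0], v).
Proof.
move=> n; have [nj lt] := prime_indexP j; rewrite -/n in nj lt.
pose S m : store := (w, [:: j - odd_primes_below m; m; m.+2; 0; 0; 0; 0; 0; 0; 0], v).
have <- : S 0 = (w, [:: j; 0; 2; 0; 0; 0; 0; 0; 0; 0], v) by rewrite /S subn0.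
have <- : S n = (w, [:: 0; n; n.+2; 0; 0; 0; 0; 0; 0; 0], v) by rewrite /S nj subnn.
set C := n.+2 * (4 * n.+2 + 20) + 40; set D := n * C.
apply: (@runs_le _ _ (n * (1 + (1 + ((D + 20) + (3 * n + 1).+2))).+2 + 1)); last by rewrite /D /C; nia.
apply: runs_while => [m mn|]; last by rewrite /S /= nj subnn.
have jm := lt _ mn; split; first by rewrite /S /=; lia.
rseq; rseq; apply: runs_seq.
  apply: runs_le (runs_count_divisors _ _ _ _ _ _) _.
  have h : m.+1 * (m.+3 * (4 * m.+3 + 20) + 40) <= D.
    apply: leq_mul => //; rewrite /C leq_add2r; apply: leq_mul; lia.
  by rewrite leq_add2r.
rewrite /S odd_primes_belowS; apply: runs_if; rewrite -ndivs_prime /=.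
have : ndivs m.+1 m.+3 <= n by rewrite (leq_trans (count_size _ _)) // size_iota.
case: eqP => h dn.
  by apply: runs_conv; [rprim|regs|rewrite /=; lia].
by apply: runs_conv; [rprim|regs|rewrite /=; lia].
Qed.

Definition mul_step :=
  Seq (While rX (Seq (Dec rX) (Seq (Move2 rA rT2 rY) (Move rT2 rA)))) (Move rY rX).

Lemma runs_mul_step w v j p1 p t1 z f a x :
  runs mul_step (w, [:: j; p1; p; t1; 0; 0; z; f; a; x], v) (x * (13 * a + 5) + 2)
    (w, [:: j; p1; p; t1; 0; 0; z; f; a; x * a], v).
Proof.
pose S m : store := (w, [:: j; p1; p; t1; 0; m * a; z; f; a; x - m], v).
have loop : runs (While rX (Seq (Dec rX) (Seq (Move2 rA rT2 rY) (Move rT2 rA)))) (S 0)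
    (x * (9 * a + 3).+2 + 1) (S x).
  apply: runs_while => [m mx|]; last by rewrite /S /= subnn.
  split; first by rewrite /S /=; lia.
  by rewrite /S; rblock.
rewrite /S subn0 mul0n subnn in loop.
apply: (@runs_le _ _ ((x * (9 * a + 3).+2 + 1) + (4 * (x * a) + 1))); last by nia.
by apply: runs_seq loop _; apply: runs_conv; [rprim|regs|rewrite /=; lia].
Qed.

Fixpoint power s := if s is s'.+1 then Seq mul_step (power s') else Skip.

Lemma runs_power s w v j p1 p t1 z f a x : 0 < a ->
  runs (power s) (w, [:: j; p1; p; t1; 0; 0; z; f; a; x], v) (s * (x * a ^ s * (13 * a + 5) + 2))
    (w, [:: j; p1; p; t1; 0; 0; z; f; a; x * a ^ s], v).
Proof.
move=> a0; elim: s x => [|s IH] x /=; first by rewrite muln1; exact: runs_skip.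
have := runs_seq (runs_mul_step w v j p1 p t1 z f a x) (IH (x * a)).
rewrite expnS mulnA => h; apply: runs_le h _; rewrite mulSn.
apply: leq_add; last by [].
rewrite leq_add2r leq_mul2r; apply/orP; right.
by rewrite -mulnA leq_pmulr // muln_gt0 a0 expn_gt0 a0.
Qed.

Definition compare :=
  Seq (Dec rX) (Seq (Dec rX) (Seq (While rP1 (Seq (Dec rP1) (Seq (Inc rT2) (Dec rX)))) (Move rT2 rP1))).

Lemma runs_compare w v j n p t1 z f a x :
  runs compare (w, [:: j; n; p; t1; 0; 0; z; f; a; x], v) (9 * n + 4)
    (w, [:: j; n; p; t1; 0; 0; z; f; a; x - n.+2], v).
Proof.
pose S m : store := (w, [:: j; n - m; p; t1; m; 0; z; f; a; x.-2 - m], v).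
have loop : runs (While rP1 (Seq (Dec rP1) (Seq (Inc rT2) (Dec rX)))) (S 0) (n * 3.+2 + 1) (S n).
  apply: runs_while => [m mx|]; last by rewrite /S /= subnn.
  split; first by rewrite /S /=; lia.
  by rewrite /S; rblock.
rewrite /S !subn0 subnn in loop.
apply: (@runs_le _ _ (1 + (1 + ((n * 3.+2 + 1) + (4 * n + 1))))); last by lia.
rseq; rseq; apply: runs_seq loop _.
by apply: runs_conv; [rprim|regs|rewrite /=; lia].
Qed.

Definition outs (l : seq bool) := foldr (fun b c => Seq (Out b) c) Skip l.

Lemma runs_outs l w s v : runs (outs l) (w, s, v) (size l) (w, s, v ++ l).
Proof.
elim: l v => [|b l IH] v /=; first by rewrite cats0; exact: runs_skip.
by rewrite -cat_rcons -add1n; apply: runs_seq (IH _); exact: runs_out.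
Qed.

Lemma runs_while_step i c x y z B B' : x.1.2`_[i] != 0 -> runs c x B y ->
  runs (While i c) y B' z -> runs (While i c) x (B + B').+2 z.
Proof.
case: x => [[w s] v] /= s0 [t tB e] [t' tB' e'].
by exists (t + t').+2; [rewrite !ltnS leq_add | exact: ExecWhile e e'].
Qed.

Lemma runs_while_done i c x : x.1.2`_[i] = 0 -> runs (While i c) x 1 x.
Proof. by case: x => [[w s] v] /= s0; exists 1 => //; exact: ExecWhileDone. Qed.

(** The quotient by 2 goes to rZ, the remainder to rF. *)
Definition halve := While rY (Seq (Dec rY) (IfZ rY (Inc rF) (Seq (Dec rY) (Inc rZ)))).

Lemma runs_halve w v j p1 p t1 y z a x :
  runs halve (w, [:: j; p1; p; t1; 0; y; z; 0; a; x], v) (7 * y + 1)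
    (w, [:: j; p1; p; t1; 0; 0; z + y./2; nat_of_bool (odd y); a; x], v).
Proof.
elim/ltn_ind: y z => -[|[|y]] IH z.
- by rewrite addn0; exact: runs_while_done.
- apply: (@runs_le _ _ ((1 + 1.+2) + 1).+2) => //; apply: runs_while_step => //.
    by rseq; apply: runs_if => /=; rprim.
  by rewrite /= addn0; exact: runs_while_done.
have := IH y (ltnW (ltnSn _)) z.+1 => h.
apply: (@runs_le _ _ ((1 + (1 + 1).+2) + (7 * y + 1)).+2); last by lia.
apply: runs_while_step => //; last first.
  by move: h; congr runs; rewrite /= negbK; regs.
by rseq; apply: runs_if => /=; rseq; rprim.
Qed.

Definition emit_digits := While rY (Seq (Out true) (Seq halve
  (Seq (IfZ rF (Out false) (Seq (Dec rF) (Out true))) (Move rZ rY)))).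

Definition digits n := flatten [seq [:: true; b] | b <- binary n].

Lemma runs_emit_digits w v j p1 p t1 y a x :
  runs emit_digits (w, [:: j; p1; p; t1; 0; y; 0; 0; a; x], v) (y * (11 * y + 20) + 1)
    (w, [:: j; p1; p; t1; 0; 0; 0; 0; a; x], v ++ digits y).
Proof.
elim/ltn_ind: y v => y IH v; have [->|y0] := posnP y.
  by rewrite /digits binary0 cats0; exact: runs_while_done.
have yh := odd_double_half y; rewrite -muln2 in yh.
have h2 : y./2 < y by lia.
have h := IH _ h2 (v ++ [:: true; odd y]).
apply: (@runs_le _ _ ((1 + ((7 * y + 1) + ((1 + 1).+2 + (4 * y./2 + 1)))) + (y./2 * (11 * y./2 + 20) + 1)).+2).
  apply: runs_while_step; first by rewrite /=; lia.
    rseq; apply: runs_seq; first exact: runs_halve.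
    apply: (@runs_seq _ _ _ (w, [:: j; p1; p; t1; 0; 0; 0 + y./2; 0; a; x], rcons (rcons v true) (odd y))).
      apply: runs_if; case: (odd y) => /=; last by apply: runs_le (runs_out _ _ _ _) _.
      by rseq; rprim.
    by apply: runs_conv; [rprim|reflexivity|rewrite /=; lia].
  rewrite /= !add0n -!cats1 -catA /=; move: h; rewrite -catA.
  by rewrite /digits (binaryS y0).
by nia.
Qed.

Definition zero_coef := true :: encode_rat 0.

Definition emit :=
  Seq (outs [:: true; true; true])
 (Seq (Move2 rA rT2 rY) (Seq (Move rT2 rA)
 (Seq emit_digits (Seq (outs [:: false; true; true; false])
 (Seq (While rP1 (Seq (Dec rP1) (Seq (Inc rT2) (outs zero_coef))))
 (Seq (Move rT2 rP1)
 (outs (zero_coef ++ true :: encode_rat 1 ++ [:: false])))))))).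

Lemma encode_rat0 : encode_rat 0 = [:: false; false; true; true; false].
Proof. by []. Qed.

Lemma encode_rat1 : encode_rat 1 = [:: false; true; true; false; true; true; false].
Proof. by []. Qed.

Lemma encode_rat_opp a : 0 < a ->
  encode_rat (- a%:R)%R = true :: digits a ++ [:: false; true; true; false].
Proof.
move=> a0; have -> : (- a%:R)%R = ((- (a%:Z))%:~R)%R :> rat by rewrite rmorphN.
rewrite /encode_rat numq_int denq_int oppr_lt0 ltz_nat a0 abszN.
by rewrite /encode_nat /encode_seq -catA; congr (_ :: _ ++ _).
Qed.

Definition radical_poly n a : {poly rat} := ('X^(n.+2) - a%:R%:P)%R.

Lemma polyseq_radical n a :
  radical_poly n a = [:: (- a%:R)%R] ++ nseq n.+1 0%R ++ [:: 1%R] :> seq rat.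
Proof.
apply: (@eq_from_nth _ 0%R); first by rewrite size_XnsubC //= size_cat size_nseq /= addn1.
move=> [|i] _; rewrite coefB coefXn coefC; first by rewrite /= sub0r.
transitivity (nth 0%R (nseq n.+1 0%R ++ [:: 1%R]) i : rat); last by [].
rewrite (_ : (if i.+1 == 0 then a%:R else 0)%R = 0%R :> rat) // subr0 eqSS nth_cat size_nseq nth_nseq.
case: ltngtP => // h; last by rewrite h subnn.
by rewrite nth_default // subn_gt0.
Qed.

Definition poly_word n a := true :: encode_seq encode_rat (radical_poly n a).

Lemma encode_seq_radical (enc : rat -> seq bool) n a : encode_seq enc (radical_poly n a) =
  true :: enc (- a%:R)%R ++ flatten (nseq n (true :: enc 0%R)) ++
  (true :: enc 0%R) ++ (true :: enc 1%R) ++ [:: false].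
Proof.
rewrite polyseq_radical -[n.+1]addn1 nseqD /encode_seq !map_cat !flatten_cat map_nseq /=.
by rewrite !cats0 -!catA.
Qed.

Lemma poly_wordE n a : 0 < a -> poly_word n a =
  [:: true; true; true] ++ digits a ++ [:: false; true; true; false] ++
  flatten (nseq n zero_coef) ++ zero_coef ++ true :: encode_rat 1 ++ [:: false].
Proof.
by move=> a0; rewrite /poly_word encode_seq_radical encode_rat_opp // cat_cons -catA.
Qed.

Lemma flatten_nseqS (T : Type) (z : seq T) m : flatten (nseq m.+1 z) = flatten (nseq m z) ++ z.
Proof. by rewrite -[m.+1]addn1 nseqD flatten_cat /= cats0. Qed.

Lemma runs_emit w v n p t1 a : 0 < a ->
  runs emit (w, [:: 0; n; p; t1; 0; 0; 0; 0; a; 0], v) (a * (11 * a + 40) + 20 * n + 50)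
    (w, [:: 0; n; p; t1; 0; 0; 0; 0; a; 0], v ++ poly_word n a).
Proof.
move=> a0; rewrite poly_wordE // !catA.
set v1 := v ++ _; set v2 := v1 ++ _; set v3 := v2 ++ _.
pose S m : store := (w, [:: 0; n - m; p; t1; m; 0; 0; 0; a; 0], v3 ++ flatten (nseq m zero_coef)).
have zs : size zero_coef = 6 by rewrite /zero_coef encode_rat0.
have loop : runs (While rP1 (Seq (Dec rP1) (Seq (Inc rT2) (outs zero_coef)))) (S 0) (n * 8.+2 + 1) (S n).
  apply: runs_while => [m mx|]; last by rewrite /S /= subnn.
  split; first by rewrite /S /=; lia.
  apply: (@runs_le _ _ (1 + (1 + size zero_coef))); last by rewrite zs.
  rseq; rseq; have := runs_outs zero_coef w [:: 0; (n - m).-1; p; t1; m.+1; 0; 0; 0; a; 0] (v3 ++ flatten (nseq m zero_coef)).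
  congr runs; rewrite /S flatten_nseqS catA.
  by congr (_, [:: _; _; _; _; _; _; _; _; _; _], _); lia.
rewrite {1}/S subn0 /= cats0 in loop.
apply: (@runs_le _ _ (3 + ((5 * a + 1) + ((4 * a + 1) + ((a * (11 * a + 20) + 1) + (4 + ((n * 8.+2 + 1) +
  ((4 * n + 1) + 15)))))))); last by nia.
apply: runs_seq; first exact: (runs_outs [:: true; true; true]).
apply: runs_seq; first by apply: runs_conv; [rprim|rewrite /=; reflexivity|rewrite /=; lia].
apply: runs_seq; first by apply: runs_conv; [rprim|rewrite /=; reflexivity|rewrite /=; lia].
apply: runs_seq; first by apply: runs_conv; [exact: runs_emit_digits|reflexivity|].
apply: runs_seq; first exact: (runs_outs [:: false; true; true; false]).
apply: runs_seq; first exact: loop.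
rewrite /S subnn; apply: runs_seq; first by apply: runs_conv; [rprim|rewrite /=; reflexivity|rewrite /=; lia].
rewrite -catA; apply: runs_conv; [exact: runs_outs|by []|].
by rewrite /zero_coef encode_rat0 encode_rat1.
Qed.

Section Program.
Variable s : nat.

Definition emit_all := While rP (Seq (Dec rP) (Seq (Inc rT1)
  (Seq (Inc rA) (Seq (Inc rX) (Seq (power s) (Seq compare (IfZ rX emit (Clear rX)))))))).

Definition small_radicands n m := [seq a <- iota 1 m | a ^ s <= n.+2].

Definition emit_bound p :=
  p * (s * (p ^ s * (13 * p + 5) + 2) + 9 * p + 3 * p ^ s + p * (11 * p + 40) + 20 * p + 70) + 1.

Lemma runs_emit_all w v n :
  runs emit_all (w, [:: 0; n; n.+2; 0; 0; 0; 0; 0; 0; 0], v) (emit_bound n.+2)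
    (w, [:: 0; n; 0; n.+2; 0; 0; 0; 0; n.+2; 0],
      v ++ flatten [seq poly_word n a | a <- small_radicands n n.+2]).
Proof.
set p := n.+2.
pose S m : store := (w, [:: 0; n; p - m; m; 0; 0; 0; 0; m; 0],
  v ++ flatten [seq poly_word n a | a <- small_radicands n m]).
have <- : S 0 = (w, [:: 0; n; p; 0; 0; 0; 0; 0; 0; 0], v) by rewrite /S subn0 /= cats0.
have <- : S p = (w, [:: 0; n; 0; p; 0; 0; 0; 0; p; 0],
  v ++ flatten [seq poly_word n a | a <- small_radicands n p]) by rewrite /S subnn.
set Bp := s * (p ^ s * (13 * p + 5) + 2).
set Be := 3 * p ^ s + p * (11 * p + 40) + 20 * p + 51.
apply: (@runs_le _ _ (p * (1 + (1 + (1 + (1 + (Bp + (9 * n + 4 + Be.+2)))))).+2 + 1)); last first.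
  by rewrite /emit_bound -/Bp leq_add2r leq_mul2l; apply/orP; right; rewrite /Be /p; lia.
apply: runs_while => [m mp|]; last by rewrite /S /= subnn.
split; first by rewrite /S /=; lia.
rseq; rseq; rseq; rseq.
have ps : m.+1 ^ s <= p ^ s by case: (s) => // s'; rewrite leq_exp2r.
apply: runs_seq.
  apply: runs_le; first exact: runs_power.
  by rewrite mul1n leq_mul2l leq_add2r leq_mul ?orbT //; lia.
apply: runs_seq; first exact: runs_compare.
have SE : S m.+1 = (w, [:: 0; n; (p - m).-1; m.+1; 0; 0; 0; 0; m.+1; 0],
    (v ++ flatten [seq poly_word n a | a <- small_radicands n m]) ++
      if m.+1 ^ s <= p then poly_word n m.+1 else [::]).
  rewrite /S (_ : p - m.+1 = (p - m).-1); last by lia.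
  rewrite -catA; congr (_, _, _ ++ _).
  rewrite /small_radicands -[m.+1]addn1 iotaD filter_cat map_cat flatten_cat /= add1n addn1 -/p.
  by case: ifP => _ //=; rewrite cats0.
rewrite SE; apply: runs_if; rewrite /= mul1n subn_eq0 -/p; case: ifP => h.
  rewrite (eqP h); apply: runs_le; first exact: runs_emit.
  rewrite /Be -/p; have : m.+1 * (11 * m.+1 + 40) <= p * (11 * p + 40) by apply: leq_mul; lia.
  by rewrite /p; lia.
rewrite cats0; apply: runs_conv; [rprim|by []|].
by rewrite /= /Be; lia.
Qed.

(** The first two instructions extend the list of registers, which is empty at
    the start, to its full length. *)
Definition program :=
  Seq (Inc rX) (Seq (Dec rX) (Seq (Inc rA)
 (Seq (ForInput read_bit0 read_bit1) (Seq (Clear rA) (Seq (Inc rP) (Seq (Inc rP)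
 (Seq find_prime (Seq emit_all (Out false))))))))).

Definition radical_family p : seq {poly rat} :=
  [seq ('X^p - a%:R%:P)%R | a <- iota 1 p & a ^ s <= p].

Definition time_bound p :=
  (2 * p + 1) * (14 * (2 * p + 1) + 5) + 3 * (2 * p + 1) +
  p * (p * (p * (4 * p + 20) + 40) + 3 * p + 30) + emit_bound p + 20.

Lemma runs_program j : exists cs,
  runs program (binary j, [::], [::]) (time_bound (nth_prime j))
    ([::], cs, encode_polys (radical_family (nth_prime j))).
Proof.
set p := nth_prime j; set n := prime_index j; have pE : p = n.+2 by [].
have w2 := binary_size j; set W := 2 ^ size (binary j) in w2.
have jp : j <= p := leq_nth_prime j.
have wp : W <= 2 * p + 1 by apply: leq_trans w2 _; case: eqP => _ /=; lia.
have sp : size (binary j) <= 2 * p + 1 by apply: leq_trans wp; rewrite ltnW // ltn_expl.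
exists [:: 0; n; 0; n.+2; 0; 0; 0; 0; n.+2; 0].
apply: (@runs_le _ _ (1 + (1 + (1 + (((2 * p + 1) * (14 * (2 * p + 1) + 5) + 1) + ((3 * (2 * p + 1) + 1) + (1 + (1 +
  ((p * (p * (p * (4 * p + 20) + 40) + 3 * p + 30) + 1) + (emit_bound p + 1)))))))))); last first.
  by rewrite /time_bound; lia.
rseq; rseq; rseq; apply: runs_seq.
  apply: runs_le; first exact: runs_read_input.
  by rewrite leq_add2r leq_mul // leq_add2r leq_mul2l -/W mul1n wp orbT.
rewrite -/W binary_value !mul1n add0n; apply: runs_seq.
  by apply: runs_conv; [rprim|rewrite /=; reflexivity|rewrite /=; lia].
rseq; rseq; apply: runs_seq.
  apply: runs_le; first exact: runs_find_prime.
  rewrite leq_add2r -/n; apply: leq_mul; first by lia.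
  rewrite pE leq_add2r; apply: leq_add; last by lia.
  apply: leq_mul; first by lia.
  by [].
apply: runs_seq; first by apply: runs_emit_all.
rewrite -/n; have -> : encode_polys (radical_family p) =
    rcons (flatten [seq poly_word n a | a <- small_radicands n n.+2]) false.
  rewrite /encode_polys {1}/encode_seq cats1 /radical_family -map_comp; congr (rcons (flatten _) _).
by rprim.
Qed.

Lemma program_counters : counters_below 10 program.
Proof.
suff : counters_below 10 (power s) by move=> h; rewrite /= h.
by elim: (s) => //= k ->.
Qed.

Theorem program_correct j : exists2 t, t <= 2 * time_bound (nth_prime j) + 3 &
  computes_within (machine_of 10 program) t (binary j) (encode_polys (radical_family (nth_prime j))).
Proof.
have [cs [t tB e]] := runs_program j.
eexists; last exact: machine_of_correct program_counters e.
by have := exec_size_output e => /=; lia.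
Qed.

(** Bounds by a power of p, for p >= 2, are closed under sums and products, so
    that the running time need not be expanded. *)
Definition poly_bounded (f : nat -> nat) := exists k, forall p, 2 <= p -> f p <= p ^ k.

Lemma poly_bounded_const c : poly_bounded (fun _ => c).
Proof.
exists c => p p2; apply: leq_trans (ltnW (ltn_expl c (ltnSn 1))) _.
by case: c => // c; rewrite leq_exp2r.
Qed.

Lemma poly_bounded_id : poly_bounded id.
Proof. by exists 1 => p _; rewrite expn1. Qed.

Lemma poly_boundedM f g : poly_bounded f -> poly_bounded g -> poly_bounded (fun p => f p * g p).
Proof.
move=> [k fk] [l gl]; exists (k + l) => p p2.
by rewrite expnD leq_mul ?fk ?gl.
Qed.

Lemma poly_boundedD f g : poly_bounded f -> poly_bounded g -> poly_bounded (fun p => f p + g p).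
Proof.
move=> [k fk] [l gl]; exists (maxn k l).+1 => p p2.
apply: (@leq_trans (p ^ maxn k l + p ^ maxn k l)).
  have p0 := ltnW p2; apply: leq_add.
    by apply: leq_trans (fk p p2) _; rewrite leq_pexp2l // leq_maxl.
  by apply: leq_trans (gl p p2) _; rewrite leq_pexp2l // leq_maxr.
by rewrite addnn -mul2n expnS leq_mul2r p2 orbT.
Qed.

Lemma poly_boundedX k : poly_bounded (fun p => p ^ k).
Proof. by exists k. Qed.

Lemma time_poly_bounded : poly_bounded (fun p => 2 * time_bound p + 3).
Proof.
rewrite /time_bound /emit_bound.
do ![apply: poly_boundedD | apply: poly_boundedM | exact: poly_bounded_const
  | exact: poly_bounded_id | exact: poly_boundedX].
Qed.
End Program.

End TuringMachines.

(** * The family of fields *)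

Lemma filter_iota_downclosed (P : pred nat) m : (forall a b, (a <= b)%N -> P b -> P a) ->
  exists N, [/\ (N <= m)%N, [seq a <- iota 1 m | P a] = iota 1 N,
    (0 < N)%N -> P N & (N < m)%N -> ~~ P N.+1].
Proof.
move=> Pd; elim: m => [|m [N [Nm fE PN PN1]]]; first by exists 0%N.
have iE : iota 1 m.+1 = iota 1 m ++ [:: m.+1] by rewrite -[m.+1]addn1 iotaD add1n addn1.
rewrite iE filter_cat fE /=; case: ifP => Pm; last first.
  exists N; rewrite cats0; split=> // [|_]; first exact: leqW.
  move: Nm; rewrite leq_eqVlt => /predU1P[->|]; [by rewrite Pm|exact: PN1].
have NE : N = m.
  apply/eqP; rewrite eqn_leq Nm leqNgt; apply/negP => /[dup] Nlt /PN1 /negP; apply.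
  by apply: Pd Pm; lia.
exists m.+1; rewrite NE -iE; split=> //.
by rewrite ltnn.
Qed.

Lemma primes_upto_mono m n : (m <= n)%N -> (size (primes_upto m) <= size (primes_upto n))%N.
Proof. by move/subnKC <-; rewrite /primes_upto iotaD filter_cat size_cat leq_addr. Qed.

Definition radical_rank s p := count (fun a => prime a && (a ^ s <= p)%N) (iota 1 p).

Lemma radical_rank_mono s p p' : (p <= p')%N -> (radical_rank s p <= radical_rank s p')%N.
Proof.
move=> pp'; rewrite -(subnKC pp') /radical_rank iotaD count_cat.
apply: leq_trans (leq_addr _ _); apply: sub_count => a /andP[-> ap] /=.
by rewrite subnKC // (leq_trans ap).
Qed.

(** The two inequalities are those that matter asymptotically: C bounds the root
    discriminant, and its s-th power is small because the primes that are
    adjoined are at most p^(1/s); the rank r is at least a fixed power of p by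
    Chebyshev. *)
Lemma radical_family_field s p : (1 < s)%N -> prime p ->
  let r := radical_rank s p in exists (E : fieldExtType rat) (D : rat) (C : nat),
  [/\ generated_by_roots E (radical_family s p),
      \dim {:E} = (p.-1 * p ^ r)%N, is_absdisc E D,
      D <= (C ^ \dim {:E})%:R &
   (C ^ s <= p ^ (2 * s + r))%N /\ (p <= (16 * r ^ 2 + 2) ^ s)%N].
Proof.
move=> s1 pp r; have p1 := prime_gt1 pp; have s0 := ltnW s1.
have [|N [Np fE PN PN1]] := @filter_iota_downclosed (fun a => a ^ s <= p)%N p.
  by move=> a b ab /(leq_trans _); apply; rewrite leq_exp2r.
have pps : (p < p ^ s)%N by rewrite -{1}[p]expn1 ltn_exp2l.
have N_lt : (N < p)%N.
  rewrite ltn_neqAle Np andbT; apply/eqP => NE; have := PN.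
  by rewrite NE => /(_ (ltnW p1)); rewrite leqNgt pps.
have N0 : (0 < N)%N.
  rewrite lt0n; apply/eqP => NE; have /negP := PN1 N_lt; apply.
  by rewrite NE exp1n ltnW.
have NPp := PN N0; have pN1 : (p < N.+1 ^ s)%N by rewrite ltnNge; exact: PN1.
have [|E [D [gE dimE DE Dle]]] := @radical_field_exists p N pp; first by rewrite N0.
have rE : size (primes_upto N) = r.
  by rewrite /primes_upto -fE size_filter count_filter /r /radical_rank; apply: eq_count.
rewrite rE in dimE; exists E, D, (p ^ 2 * \prod_(q <- primes_upto N) q)%N.
split=> //; first by rewrite /radical_family fE.
split.
  rewrite expnMn -expnM expnD leq_mul2l; apply/orP; right.
  apply: (@leq_trans ((N ^ r) ^ s)%N).
    rewrite leq_exp2r // -rE -[X in (_ <= _ ^ X)%N]count_predT -iter_muln_1 -big_const_seq.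
    rewrite !big_seq; apply: leq_prod => q; rewrite mem_filter mem_iota => /andP[_ ]; lia.
  by rewrite -expnM mulnC expnM; case: (r) => // r'; rewrite leq_exp2r.
apply: leq_trans (ltnW pN1) _; rewrite leq_exp2r //.
have := chebyshev_weak N./2; have := odd_double_half N.
have := @primes_upto_mono (2 * N./2) N (ltac:(have := odd_double_half N; lia)).
rewrite rE; set r' := size _ => rr' NE ch.
have : (r' ^ 2 <= r ^ 2)%N by rewrite leq_exp2r.
move: ch; move: (r' ^ 2)%N (r ^ 2)%N => x y ch xy; move: NE; rewrite -muln2.
by case: (odd N) => /=; lia.
Qed.

Lemma natpow_le_powR (R : realType) (eps : R) (s C n : nat) : (0 < s)%N -> 2 / s%:R <= eps ->
  (0 < n)%N -> (C ^ s <= n ^ 2)%N -> (C%:R : R) <= n%:R `^ eps.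
Proof.
move=> s0 se n0 Cn; have sR : 0 < s%:R :> R by rewrite ltr0n.
have n1 : 1 <= n%:R :> R by rewrite ler1n.
apply: (@le_trans _ _ (n%:R `^ (2 / s%:R))); last exact: ler_powR.
have C0 : 0 <= C%:R :> R by [].
have -> : C%:R = (C%:R ^+ s) `^ s%:R^-1 :> R.
  by rewrite -powR_mulrn // -powRrM mulfV ?gt_eqF // powRr1.
rewrite powRrM -[2]/(2%:R) powR_mulrn // -!natrX.
by apply: ge0_ler_powR; rewrite ?invr_ge0 ?nnegrE ?ler0n ?ler_nat // ltW.
Qed.

Theorem theorem1p1 (R : realType) (eps : R) (eps_gt0 : 0 < eps) :
  exists (E : nat -> fieldExtType rat) (D : nat -> rat),
    [/\ forall j : nat, (\dim {:E j} < \dim {:E j.+1})%N,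
        efficiently_constructible R E,
        forall j : nat, is_absdisc (E j) (D j)
      & (fun j : nat => (ratr (D j) : R) `^ (\dim {:E j})%:R^-1)
          =O_\oo (fun j : nat => ((\dim {:E j})%:R : R) `^ eps)].
Proof.
pose s := (Num.bound (2 / eps)).+2.
have s1 : (1 < s)%N by [].
have s_eps : 2 / s%:R <= eps.
  rewrite ler_pdivrMr ?ltr0n // mulrC -ler_pdivrMr //.
  apply: ltW; apply: lt_trans (archi_boundP _) _; first by rewrite divr_ge0 // ltW.
  by rewrite ltr_nat leqnSn.
have /choice[F FP] j : exists X : fieldExtType rat * rat * nat,
  let: (E, D, C) := X in let p := nth_prime j in let r := radical_rank s p in
  [/\ generated_by_roots E (radical_family s p),
      \dim {:E} = (p.-1 * p ^ r)%N, is_absdisc E D,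
      D <= (C ^ \dim {:E})%:R &
   (C ^ s <= p ^ (2 * s + r))%N /\ (p <= (16 * r ^ 2 + 2) ^ s)%N].
  have [E [D [C h]]] := radical_family_field s1 (nth_prime_prime j).
  by exists (E, D, C).
pose E j := (F j).1.1; pose D j := (F j).1.2; pose C j := (F j).2.
pose p j := nth_prime j; pose r j := radical_rank s (p j).
have {}FP j :
  [/\ generated_by_roots (E j) (radical_family s (p j)),
      \dim {:E j} = ((p j).-1 * p j ^ r j)%N, is_absdisc (E j) (D j),
      D j <= (C j ^ \dim {:E j})%:R &
   (C j ^ s <= p j ^ (2 * s + r j))%N /\ (p j <= (16 * r j ^ 2 + 2) ^ s)%N].
  by rewrite /r /p /E /D /C; move: (FP j); case: (F j) => [[? ?] ?].
have p1 j : (1 < p j)%N by apply: prime_gt1; exact: nth_prime_prime.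
have dim_ge j : (p j ^ r j <= \dim {:E j})%N.
  have [_ -> _ _ _] := FP j; rewrite leq_pmull //; have := p1 j; lia.
have dim_gt0 j : (0 < \dim {:E j})%N.
  by apply: leq_trans (dim_ge j); rewrite expn_gt0 ltnW.
exists E, D; split=> [j||j|].
- have [_ -> _ _ _] := FP j; have [_ -> _ _ _] := FP j.+1.
  have pj := nth_prime_lt j; rewrite -/(p j) -/(p j.+1) in pj.
  apply: (@leq_trans ((p j.+1).-1 * p j ^ r j)).
    by rewrite ltn_mul2r expn_gt0 (ltnW (p1 j)) orTb andTb -ltnS !prednK ?(ltnW (p1 _)).
  rewrite leq_mul2l; apply/orP; right.
  apply: (@leq_trans (p j.+1 ^ r j)).
    by case: (r j) => // k; rewrite leq_exp2r // ltnW.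
  by rewrite leq_pexp2l ?(ltnW (p1 _)) // radical_rank_mono // ltnW.
- have [k kP] := time_poly_bounded s.
  pose c := (ln (2 : R))^-1.
  have ln2 : 0 < ln (2 : R) by rewrite ln_gt0 // ltr1n.
  exists (machine_of 10 (program s)), (((16 * c ^+ 2) *: 'X^2 + 2%:P) ^+ (s * k)) => j.
  have [t tB tc] := program_correct s j.
  exists t, (radical_family s (p j)); have [gE _ _ _ [_ pr]] := FP j; split=> //.
  have rL : (r j)%:R <= c * ln ((\dim {:E j})%:R : R).
    rewrite mulrC ler_pdivlMr // mulrC mulr_natr -lnXn // -natrX ler_ln ?posrE ?ltr0n ?expn_gt0 //.
    rewrite ler_nat; apply: leq_trans (dim_ge j).
    by case: (r j) => // q; rewrite leq_exp2r.
  apply: (@le_trans _ _ (((16 * r j ^ 2 + 2) ^ (s * k))%N%:R)).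
    rewrite ler_nat; apply: leq_trans tB _; apply: leq_trans (kP _ (p1 j)) _.
    by rewrite expnM; case: (k) => // k'; rewrite leq_exp2r.
  set L := ln _ in rL *.
  rewrite horner_exp hornerD hornerZ hornerXn hornerC -mulrA -exprMn natrX.
  have le2 : (r j)%:R ^+ 2 <= (c * L) ^+ 2 by rewrite ler_sqr ?nnegrE ?ler0n // (le_trans _ rL).
  apply: lerXn2r; rewrite ?nnegrE ?ler0n //.
    by rewrite addr_ge0 // mulr_ge0 // sqr_ge0.
  by rewrite natrD natrM natrX lerD2r ler_pM2l.
- by have [] := FP j.
apply/eqOP; near=> K; near=> j.
have [_ _ _ Dle [CP pr]] := FP j.
have r_large : (2 * s <= r j)%N.
  rewrite leqNgt; apply/negP => rs.
  have jp : (j <= p j)%N := leq_nth_prime j.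
  have : ((16 * (2 * s) ^ 2 + 2) ^ s < j)%N by near: j; exact: nbhs_infty_gt.
  apply/negP; rewrite -leqNgt; apply: leq_trans jp _; apply: leq_trans pr _.
  by rewrite leq_exp2r // leq_add2r leq_mul2l leq_exp2r //= ltnW.
have C_le : (C j)%:R <= (\dim {:E j})%:R `^ eps :> R.
  apply: (@natpow_le_powR R eps s) => //; apply: leq_trans CP _.
  apply: (@leq_trans ((p j ^ r j) ^ 2)); last by rewrite leq_exp2r.
  by rewrite -expnM leq_pexp2l ?(ltnW (p1 j)) //; lia.
have D0 : 0 <= D j by have [_ _ [b _ ->]] := FP j.
have root_le : (ratr (D j) : R) `^ (\dim {:E j})%:R^-1 <= (C j)%:R.
  have -> : (C j)%:R = ((C j)%:R ^+ \dim {:E j}) `^ (\dim {:E j})%:R^-1 :> R.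
    by rewrite -powR_mulrn // -powRrM mulfV ?powRr1 // pnatr_eq0 -lt0n.
  apply: ge0_ler_powR; rewrite ?invr_ge0 ?nnegrE ?ler0n ?exprn_ge0 ?ler0q //.
  by rewrite -natrX -(ratr_nat R) ler_rat.
rewrite !ger0_norm ?powR_ge0 //; apply: le_trans root_le _; apply: le_trans C_le _.
by rewrite ler_peMl ?powR_ge0 //; near: K; exact: nbhs_pinfty_ge.
Unshelve. all: by end_near.
Qed.
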